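(* The only closed bicycling geodesics in $\mathbb{R}^3$ are those whose front tracks are unit circles ($a=0$).
   Context: A bicycle path in $\mathbb{R}^3$ is a pair of curves $(\mathbf{x}(t),\mathbf{y}(t))$ (front and back tracks) such that $\mathbf{v}:=\mathbf{x}-\mathbf{y}$ satisfies $|\mathbf{v}|=1$ and $\mathbf{y}'\parallel\mathbf{v}$ for all $t$. A bicycling geodesic is a bicycle path whose length (length of the front track) between any two of its placements is critical among bicycle paths connecting these placements; it is parametrized so that $|\mathbf{x}'|=1$. It is closed if there is $T>0$ with $\mathbf{x}(t+T)=\mathbf{x}(t)$ and $\mathbf{y}(t+T)=\mathbf{y}(t)$ for all $t$. Unit speed bicycling geodesics are exactly the bicycle paths for which there exist a constant vector $\mathbf{p}\in\mathbb{R}^3$ and $\mathbf{r}(t)\in\mathbb{R}^3$ with $$\mathbf{x}'=\mathbf{p}+\mathbf{r},\quad \mathbf{v}'=\mathbf{p}+\mathbf{r}-(\mathbf{v}\cdot\mathbf{p})\mathbf{v},\quad \mathbf{p}'=0,\quad \mathbf{r}'=(\mathbf{v}\cdot\mathbf{p})\mathbf{r}-[\mathbf{r}\cdot(\mathbf{r}+\mathbf{p})]\mathbf{v},\quad |\mathbf{v}|=1,\ \mathbf{r}\cdot\mathbf{v}=0,\ |\mathbf{x}'|=1.$$ Here $b:=\mathbf{p}\cdot(\mathbf{v}\times\mathbf{x}')$ is constant, $|b|\le|\mathbf{p}|$, and $a\ge0$ is defined by $a^2=|\mathbf{p}|^2-b^2$. *)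

(* Defs.v *)
From Stdlib Require Import Reals.
From Coquelicot Require Import Coquelicot.
Open Scope R_scope.

Definition vec : Type := (R * R * R)%type.

Definition c1 (u : vec) : R := fst (fst u).
Definition c2 (u : vec) : R := snd (fst u).
Definition c3 (u : vec) : R := snd u.

Declare Scope vec_scope.
Delimit Scope vec_scope with vec.
Bind Scope vec_scope with vec.

Definition vadd (u w : vec) : vec := (c1 u + c1 w, c2 u + c2 w, c3 u + c3 w).
Definition vsub (u w : vec) : vec := (c1 u - c1 w, c2 u - c2 w, c3 u - c3 w).
Definition vscal (k : R) (u : vec) : vec := (k * c1 u, k * c2 u, k * c3 u).
Definition dot (u w : vec) : R := c1 u * c1 w + c2 u * c2 w + c3 u * c3 w.
Definition vnorm (u : vec) : R := sqrt (dot u u).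
Definition cross (u w : vec) : vec :=
  (c2 u * c3 w - c3 u * c2 w,
   c3 u * c1 w - c1 u * c3 w,
   c1 u * c2 w - c2 u * c1 w).

Infix "+" := vadd : vec_scope.
Infix "-" := vsub : vec_scope.
Infix "*" := vscal : vec_scope.

Definition smooth_curve (f : R -> vec) : Prop :=
  forall (n : nat) (t : R),
    ex_derive_n (fun s => c1 (f s)) n t /\
    ex_derive_n (fun s => c2 (f s)) n t /\
    ex_derive_n (fun s => c3 (f s)) n t.

(* Total derivative of a curve; it is only applied to smooth curves. *)
Definition vderive (f : R -> vec) (t : R) : vec :=
  (Derive (fun s => c1 (f s)) t,
   Derive (fun s => c2 (f s)) t,
   Derive (fun s => c3 (f s)) t).

(* C^oo in (e, t) jointly, on the open strip |e| < delta. *)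
Definition smooth_family (delta : R) (F : R -> R -> vec) : Prop :=
  forall (n : nat) (e t : R), Rabs e < delta ->
    ex_diff_n (fun e' t' => c1 (F e' t')) n e t /\
    ex_diff_n (fun e' t' => c2 (F e' t')) n e t /\
    ex_diff_n (fun e' t' => c3 (F e' t')) n e t.

(* The bicycle constraint at time t: |x - y| = 1 and y' parallel to x - y
   (y' = 0 is allowed). *)
Definition bicycle_at (x y : R -> vec) (t : R) : Prop :=
  vnorm (x t - y t)%vec = 1 /\
  exists k : R, vderive y t = (k * (x t - y t))%vec.

Definition bicycle_path (x y : R -> vec) : Prop :=
  smooth_curve x /\ smooth_curve y /\ forall t, bicycle_at x y t.

Definition front_length (x : R -> vec) (t0 t1 : R) : R :=
  RInt (fun t => vnorm (vderive x t)) t0 t1.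

(* (X e, Y e), |e| < delta, is a smooth one-parameter family of bicycle paths
   on [t0, t1] which passes through (x, y) at e = 0 and whose members all
   connect the placement of (x, y) at t0 to its placement at t1. *)
Record variation (x y : R -> vec) (t0 t1 delta : R) (X Y : R -> R -> vec)
  : Prop := {
  var_delta_pos : 0 < delta;
  var_smooth_front : smooth_family delta X;
  var_smooth_back : smooth_family delta Y;
  var_base : forall t, t0 <= t <= t1 -> X 0 t = x t /\ Y 0 t = y t;
  var_bicycle : forall e t, Rabs e < delta -> t0 <= t <= t1 ->
    bicycle_at (X e) (Y e) t;
  var_start : forall e, Rabs e < delta -> X e t0 = x t0 /\ Y e t0 = y t0;
  var_end : forall e, Rabs e < delta -> X e t1 = x t1 /\ Y e t1 = y t1
}.

Definition critical_between (x y : R -> vec) (t0 t1 : R) : Prop :=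
  forall (delta : R) (X Y : R -> R -> vec),
    variation x y t0 t1 delta X Y ->
    is_derive (fun e => front_length (X e) t0 t1) 0 0.

Definition unit_speed (x : R -> vec) : Prop :=
  forall t, vnorm (vderive x t) = 1.

Definition bicycling_geodesic (x y : R -> vec) : Prop :=
  bicycle_path x y /\ unit_speed x /\
  forall t0 t1, t0 < t1 -> critical_between x y t0 t1.

Definition closed_path (x y : R -> vec) : Prop :=
  exists T : R, 0 < T /\ forall t, x (t + T) = x t /\ y (t + T) = y t.

(* The image of x is the whole circle of radius 1 with centre c in the plane
   through c orthogonal to n. *)
Definition track_is_unit_circle (x : R -> vec) : Prop :=
  exists c n : vec, vnorm n = 1 /\
    forall q : vec,
      (exists t, x t = q) <-> (vnorm (q - c)%vec = 1 /\ dot n (q - c)%vec = 0).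

(* The equations satisfied by a unit speed bicycling geodesic, with
   v = x - y and p constant. *)
Record geodesic_equations (x y : R -> vec) (p : vec) (r : R -> vec) : Prop := {
  ge_smooth : smooth_curve r;
  ge_front : forall t, vderive x t = (p + r t)%vec;
  ge_v : forall t, let v := fun s => (x s - y s)%vec in
    vderive v t = (p + r t - dot (v t) p * v t)%vec;
  ge_r : forall t, let v := (x t - y t)%vec in
    vderive r t = (dot v p * r t - dot (r t) (r t + p)%vec * v)%vec;
  ge_v_unit : forall t, vnorm (x t - y t)%vec = 1;
  ge_orth : forall t, dot (r t) (x t - y t)%vec = 0;
  ge_speed : unit_speed x
}.

Definition param_b (x y : R -> vec) (p : vec) (t : R) : R :=
  dot p (cross (x t - y t)%vec (vderive x t)).

(* a >= 0 with a^2 = |p|^2 - b^2.  Along solutions of [geodesic_equations],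
   b does not depend on t (it is read off at t = 0) and |b| <= |p|. *)
Definition param_a (x y : R -> vec) (p : vec) : R :=
  sqrt (dot p p - (param_b x y p 0)^2).

(* Main.v *)
Require Import Defs.
From Stdlib Require Import Reals Lra List FunctionalExtensionality.
From Coquelicot Require Import Coquelicot.
Import Defs.
Open Scope R_scope.

(** Write [v = x - y] for the rod and [k = v . x'] for the rolling speed, so
    that [y' = k v], [x' = k v + v'] and [|x'|^2 = k^2 + |v'|^2].  All the
    conditions of the theorem are equivalent to one rigid motion, [spins]: the
    back wheel rests and the rod turns about it, [y' = 0], [v' = x'],
    [x'' = -v].  This motion is [2 PI]-periodic, its front track is a unit
    circle, and it solves the geodesic equations with [p = 0], [r = x'].

    Closed geodesics spin ([closed_roll], [nonrolling_spins]).  Dilating the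
    back track, [y + e (y - y(t0))], with the rod unchanged, gives bicycle
    paths, and over a full period it fixes both end placements.  It multiplies
    [k] by [1 + e], so the first variation of length is the integral of
    [k^2]; criticality forces [k = 0].  The back wheel then rests and [v] moves
    on the unit sphere.  Turning the rod about a fixed axis [u] by an angle
    [e phi(t)] varies the length by the integral of [phi' u . (v x v')], so the
    angular momentum [v x v'] is constant and [v] runs along a great circle.

    Geodesics with a unit circle as front track spin ([circle_spins]).  The
    back track may be displaced by any [e W] with [W' = kappa v] vanishing at
    both ends, and criticality makes [k] orthogonal to all such [kappa].
    Projecting [k] in L^2 onto the span of the three coordinates of [v] gives a
    constant [p] with [k = v . p] ([roll_multiplier]).  With
    [nu = x - c] the radius of the circle, [p . nu] is periodic, so
    [p . x'] vanishes somewhere; there [k = v . p] differentiates to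
    [v . nu = 1], that is, [y] is at the centre.  Since
    [(1 - v . nu)' = -k (1 - v . nu)], it is there at all times.

    For a solution of the geodesic equations [k = v . p], and the Gram
    determinant of [p], [v], [x'] turns [a = 0] into
    [(v . p)^2 |r|^2 + (p . x')^2 = 0]; hence [v . p = p . x' = 0] and the
    path spins ([geodesic_param_spins]).  The converse is the same identity
    ([geodesic_spins_param]). *)

(** * Derivatives of real functions *)

Lemma derive_eq (f : R -> R) (t a b : R) : is_derive f t a -> a = b -> is_derive f t b.
Proof. now intros H <-. Qed.

Lemma derive_plus (f g : R -> R) (t a b : R) :
  is_derive f t a -> is_derive g t b -> is_derive (fun s => f s + g s) t (a + b).
Proof. intros Hf Hg. exact (is_derive_plus f g t a b Hf Hg). Qed.

Lemma derive_minus (f g : R -> R) (t a b : R) :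
  is_derive f t a -> is_derive g t b -> is_derive (fun s => f s - g s) t (a - b).
Proof. intros Hf Hg. exact (is_derive_minus f g t a b Hf Hg). Qed.

Lemma derive_mult (f g : R -> R) (t a b : R) :
  is_derive f t a -> is_derive g t b ->
  is_derive (fun s => f s * g s) t (a * g t + f t * b).
Proof. intros Hf Hg. exact (is_derive_mult f g t a b Hf Hg Rmult_comm). Qed.

Lemma derive_const (c t : R) : is_derive (fun _ => c) t 0.
Proof. exact (is_derive_const c t). Qed.

Lemma derive_unique (f : R -> R) (t a b : R) :
  is_derive f t a -> is_derive f t b -> a = b.
Proof.
  intros Ha Hb. now rewrite <- (is_derive_unique f t a Ha), <- (is_derive_unique f t b Hb).
Qed.

Lemma derive_cos_comp (f : R -> R) (t a : R) :
  is_derive f t a -> is_derive (fun s => cos (f s)) t (a * - sin (f t)).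
Proof. intros Hf. exact (is_derive_comp cos f t _ a (is_derive_cos _) Hf). Qed.

Lemma derive_sin_comp (f : R -> R) (t a : R) :
  is_derive f t a -> is_derive (fun s => sin (f s)) t (a * cos (f t)).
Proof. intros Hf. exact (is_derive_comp sin f t _ a (is_derive_sin _) Hf). Qed.

Lemma derive_exp_comp (f : R -> R) (t a : R) :
  is_derive f t a -> is_derive (fun s => exp (f s)) t (a * exp (f t)).
Proof. intros Hf. exact (is_derive_comp exp f t _ a (is_derive_exp _) Hf). Qed.

Lemma derive_continuous (f : R -> R) (t a : R) : is_derive f t a -> continuous f t.
Proof. intros H. apply (ex_derive_continuous f). now exists a. Qed.

Lemma derive_continuity_pt (f : R -> R) (t a : R) : is_derive f t a -> continuity_pt f t.
Proof. intros H. apply continuity_pt_filterlim. exact (derive_continuous f t a H). Qed.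

Lemma constant_of_derive_zero (f : R -> R) :
  (forall t, is_derive f t 0) -> forall s t, f s = f t.
Proof.
  intros Hf s t. destruct (Rtotal_order s t) as [H | [-> | H]]; trivial.
  - exact (eq_is_derive f s t (fun u _ => Hf u) H).
  - symmetry. exact (eq_is_derive f t s (fun u _ => Hf u) H).
Qed.

Lemma derive_zero_of_constant_on (f : R -> R) (a b c l t : R) :
  (forall s, a < s < b -> f s = c) -> a < t < b -> is_derive f t l -> l = 0.
Proof.
  intros Hc Ht Hf. refine (derive_unique _ _ _ _ Hf _).
  apply (is_derive_ext_loc (fun _ => c)); [| apply derive_const].
  assert (Hpos : 0 < Rmin (t - a) (b - t)) by (apply Rmin_pos; lra).
  exists (mkposreal _ Hpos). intros u Hu.
  change (Rabs (u - t) < Rmin (t - a) (b - t)) in Hu.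
  assert (Rmin (t - a) (b - t) <= t - a) by apply Rmin_l.
  assert (Rmin (t - a) (b - t) <= b - t) by apply Rmin_r.
  apply Rabs_def2 in Hu. symmetry. apply Hc. lra.
Qed.

(** Here [F] is a primitive of [m^2], hence monotone; equal end values make it
    constant between them.  This is how each first variation is exploited: the
    variation field is chosen so that its first variation is a square. *)
Lemma integral_square_zero (F m : R -> R) (a b : R) :
  (forall t, is_derive F t (m t * m t)) -> F a = F b ->
  forall t, a < t < b -> m t = 0.
Proof.
  intros HF Hab t Ht.
  assert (Hmono : forall s u, s <= u -> F s <= F u).
  { intros s u Hsu.
    destruct (MVT_gen F s u (fun z => m z * m z)) as [z [_ Hz]].
    - intros; apply HF.
    - intros; eapply derive_continuity_pt; apply HF.
    - assert (0 <= m z * m z) by apply Rle_0_sqr. nra. }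
  apply Rsqr_0_uniq. refine (derive_zero_of_constant_on F a b (F a) _ t _ Ht (HF t)).
  intros s Hs. apply Rle_antisym; [rewrite Hab|]; apply Hmono; lra.
Qed.

(** * Smooth functions of one and of two variables *)

Definition smooth (f : R -> R) : Prop := forall n t, ex_derive_n f n t.

(** A class of functions closed under differentiation consists of smooth
    functions.  Closure of smoothness under products and the like then needs no
    Leibniz formula for higher derivatives, only a class containing its own
    derivatives. *)
Lemma smooth_coind (P : (R -> R) -> Prop) :
  (forall f, P f -> exists g, P g /\ forall t, is_derive f t (g t)) ->
  forall f, P f -> smooth f.
Proof.
  intros HP f Hf.
  assert (HD : forall n, P (Derive_n f n)).
  { induction n as [|n IH]; [exact Hf|].
    destruct (HP _ IH) as [g [Hg Hd]].
    replace (Derive_n f (S n)) with g; trivial.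
    apply functional_extensionality; intros t.
    symmetry. exact (is_derive_unique _ _ _ (Hd t)). }
  intros [|n] t; [exact I|].
  destruct (HP _ (HD n)) as [g [_ Hd]]. exists (g t). apply Hd.
Qed.

Lemma smooth_derive (f : R -> R) :
  smooth f -> smooth (Derive f) /\ forall t, is_derive f t (Derive f t).
Proof.
  intros Hf. split.
  - intros [|n] t; [exact I|]. specialize (Hf (S (S n)) t).
    change (ex_derive (Derive_n f (S n)) t) in Hf.
    change (ex_derive (Derive_n (Derive_n f 1) n) t).
    eapply ex_derive_ext; [|exact Hf].
    intros u. rewrite Derive_n_comp. now rewrite Nat.add_1_r.
  - intros t. apply Derive_correct. exact (Hf 1%nat t).
Qed.

Lemma smooth_of_derive (f g : R -> R) :
  smooth g -> (forall t, is_derive f t (g t)) -> smooth f.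
Proof.
  intros Hg Hf.
  apply (smooth_coind (fun h => h = f \/ smooth h)); [|now left].
  intros h [-> | Hh].
  - exists g. auto.
  - exists (Derive h). destruct (smooth_derive h Hh). auto.
Qed.

Lemma smooth_continuous (f : R -> R) : smooth f -> forall t, continuous f t.
Proof. intros Hf t. eapply derive_continuous. now apply smooth_derive. Qed.

(** Products alone are not stable under differentiation; the sums of products
    generated here are. *)
Inductive smooth_algebra : (R -> R) -> Prop :=
| algebra_gen f : smooth f -> smooth_algebra f
| algebra_plus f g :
    smooth_algebra f -> smooth_algebra g -> smooth_algebra (fun t => f t + g t)
| algebra_mult f g :
    smooth_algebra f -> smooth_algebra g -> smooth_algebra (fun t => f t * g t).

Lemma smooth_algebra_smooth (f : R -> R) : smooth_algebra f -> smooth f.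
Proof.
  revert f. apply smooth_coind. intros f Hf.
  induction Hf as [f Hf | f g Hf [f' [If Df]] Hg [g' [Ig Dg]]
                        | f g Hf [f' [If Df]] Hg [g' [Ig Dg]]].
  - exists (Derive f). destruct (smooth_derive f Hf). split; trivial. now apply algebra_gen.
  - exists (fun t => f' t + g' t). split; [now apply algebra_plus|].
    intros t; now apply derive_plus.
  - exists (fun t => f' t * g t + f t * g' t).
    split; [apply algebra_plus; now apply algebra_mult|].
    intros t; now apply derive_mult.
Qed.

Lemma smooth_plus (f g : R -> R) : smooth f -> smooth g -> smooth (fun t => f t + g t).
Proof. intros; apply smooth_algebra_smooth, algebra_plus; now apply algebra_gen. Qed.

Lemma smooth_mult (f g : R -> R) : smooth f -> smooth g -> smooth (fun t => f t * g t).
Proof. intros; apply smooth_algebra_smooth, algebra_mult; now apply algebra_gen. Qed.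

Lemma smooth_const (c : R) : smooth (fun _ => c).
Proof.
  apply (smooth_coind (fun f => exists c, f = fun _ => c)); [|now exists c].
  intros f [d ->]. exists (fun _ => 0). split; [now exists 0|]. apply derive_const.
Qed.

Lemma smooth_minus (f g : R -> R) : smooth f -> smooth g -> smooth (fun t => f t - g t).
Proof.
  intros Hf Hg.
  replace (fun t => f t - g t) with (fun t => f t + (-1) * g t)
    by (apply functional_extensionality; intros; ring).
  apply smooth_plus; trivial. apply smooth_mult; trivial. apply smooth_const.
Qed.

(** The primitive is tied to [RInt] so that orthogonality relations between
    functions can be read as end values of primitives. *)
Lemma smooth_primitive (g : R -> R) (a : R) :
  smooth g -> exists G, smooth G /\ G a = 0 /\ (forall t, is_derive G t (g t)) /\
                        forall b, G b = RInt g a b.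
Proof.
  intros Hg. assert (Cg := smooth_continuous g Hg).
  assert (DG : forall t, is_derive (RInt g a) t (g t)).
  { intros t. apply (is_derive_RInt g (RInt g a) a t); [|apply Cg].
    apply filter_forall. intros b. apply (@RInt_correct R_CompleteNormedModule).
    apply @ex_RInt_continuous. intros; apply Cg. }
  exists (RInt g a). split; [now apply (smooth_of_derive _ g)|].
  split; [exact (RInt_point a g)|]. split; trivial.
Qed.

(** Two-variable analogue of [smooth_coind]. *)
Lemma ex_diff_n_coind (P : (R -> R -> R) -> Prop) :
  (forall F, P F -> (forall e t, continuity_2d_pt F e t) /\
     (exists G, P G /\ forall e t, is_derive (fun z => F z t) e (G e t)) /\
     (exists G, P G /\ forall e t, is_derive (fun z => F e z) t (G e t))) ->
  forall F, P F -> forall n e t, ex_diff_n F n e t.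
Proof.
  intros HP F HF n. revert F HF. induction n as [|n IH]; intros F HF e t;
    destruct (HP F HF) as [HC [[G [HG DG]] [H [HH DH]]]].
  - split; [apply HC | exact I].
  - split; [apply HC|]. split; [eexists; apply DG|]. split; [eexists; apply DH|].
    split.
    + replace (fun u v => Derive (fun z => F z v) u) with G; [now apply IH|].
      do 2 (apply functional_extensionality; intro).
      symmetry. apply is_derive_unique, DG.
    + replace (fun u v => Derive (fun z => F u z) v) with H; [now apply IH|].
      do 2 (apply functional_extensionality; intro).
      symmetry. apply is_derive_unique, DH.
Qed.

(** The functions of the parameter [e] and the time [t] that occur as
    coordinates of the variations below; both partial derivatives of a member
    are again members. *)
Inductive smooth2 : (R -> R -> R) -> Prop :=
| smooth2_time g : smooth g -> smooth2 (fun _ t => g t)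
| smooth2_param : smooth2 (fun e _ => e)
| smooth2_plus F G : smooth2 F -> smooth2 G -> smooth2 (fun e t => F e t + G e t)
| smooth2_mult F G : smooth2 F -> smooth2 G -> smooth2 (fun e t => F e t * G e t)
| smooth2_cos phi : smooth phi -> smooth2 (fun e t => cos (e * phi t))
| smooth2_sin phi : smooth phi -> smooth2 (fun e t => sin (e * phi t)).

Lemma smooth2_const (c : R) : smooth2 (fun _ _ => c).
Proof. exact (smooth2_time (fun _ => c) (smooth_const c)). Qed.

Lemma continuity_2d_time (g : R -> R) (e t : R) :
  smooth g -> continuity_2d_pt (fun _ v => g v) e t.
Proof.
  intros Hg. apply (continuity_1d_2d_pt_comp g (fun _ v => v)).
  - apply continuity_pt_filterlim, (smooth_continuous g Hg).
  - apply continuity_2d_pt_id2.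
Qed.

Lemma smooth2_ex_diff_n (F : R -> R -> R) :
  smooth2 F -> forall n e t, ex_diff_n F n e t.
Proof.
  revert F. apply ex_diff_n_coind. intros F HF.
  assert (Hangle : forall phi e t, smooth phi ->
            continuity_2d_pt (fun u v => u * phi v) e t).
  { intros phi e t Hp. apply continuity_2d_pt_mult; [apply continuity_2d_pt_id1|].
    now apply continuity_2d_time. }
  assert (De : forall phi e : R, is_derive (fun z => z * phi) e phi).
  { intros phi e.
    eapply derive_eq; [apply (derive_mult (fun z => z) (fun _ => phi));
      [apply @is_derive_id | apply derive_const] | unfold one; simpl; ring]. }
  assert (Dt : forall phi e t, smooth phi ->
            is_derive (fun z => e * phi z) t (e * Derive phi t)).
  { intros phi e t Hp. apply is_derive_scal. now apply smooth_derive. }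
  induction HF as [g Hg | | F G HF [CF [[F1 [HF1 DF1]] [F2 [HF2 DF2]]]]
                            HG [CG [[G1 [HG1 DG1]] [G2 [HG2 DG2]]]]
                  | F G HF [CF [[F1 [HF1 DF1]] [F2 [HF2 DF2]]]]
                            HG [CG [[G1 [HG1 DG1]] [G2 [HG2 DG2]]]]
                  | phi Hp | phi Hp].
  - split; [intros; now apply continuity_2d_time|]. split.
    + exists (fun _ _ => 0). split; [apply smooth2_const|]. intros; apply derive_const.
    + exists (fun _ => Derive g). destruct (smooth_derive g Hg).
      split; [now apply (smooth2_time (Derive g))|]. auto.
  - split; [intros; apply continuity_2d_pt_id1|]. split.
    + exists (fun _ _ => 1). split; [apply smooth2_const|]. intros; apply @is_derive_id.
    + exists (fun _ _ => 0). split; [apply smooth2_const|]. intros; apply derive_const.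
  - split; [intros; now apply continuity_2d_pt_plus|]. split.
    + exists (fun e t => F1 e t + G1 e t). split; [now apply smooth2_plus|].
      intros; now apply (derive_plus (fun z => F z t) (fun z => G z t)).
    + exists (fun e t => F2 e t + G2 e t). split; [now apply smooth2_plus|].
      intros; now apply (derive_plus (fun z => F e z) (fun z => G e z)).
  - split; [intros; now apply continuity_2d_pt_mult|]. split.
    + exists (fun e t => F1 e t * G e t + F e t * G1 e t).
      split; [apply smooth2_plus; now apply smooth2_mult|].
      intros; now apply (derive_mult (fun z => F z t) (fun z => G z t)).
    + exists (fun e t => F2 e t * G e t + F e t * G2 e t).
      split; [apply smooth2_plus; now apply smooth2_mult|].
      intros; now apply (derive_mult (fun z => F e z) (fun z => G e z)).
  - assert (Hn : smooth2 (fun e t => (-1) * sin (e * phi t)))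
      by (apply (smooth2_mult (fun _ _ => -1)); [apply smooth2_const | now apply smooth2_sin]).
    destruct (smooth_derive phi Hp) as [Hp' _].
    split; [|split].
    + intros e t. apply (continuity_1d_2d_pt_comp cos); [apply continuity_cos | now apply Hangle].
    + exists (fun e t => phi t * ((-1) * sin (e * phi t))).
      split; [apply (smooth2_mult (fun _ t => phi t)); [now apply smooth2_time | exact Hn]|].
      intros e t. eapply derive_eq; [apply derive_cos_comp; now apply De | cbv beta; ring].
    + exists (fun e t => (e * Derive phi t) * ((-1) * sin (e * phi t))).
      split; [apply (smooth2_mult (fun e t => e * Derive phi t)); [|exact Hn]|].
      * apply (smooth2_mult (fun e _ => e)); [apply smooth2_param | now apply smooth2_time].
      * intros e t. eapply derive_eq; [apply derive_cos_comp; now apply Dt | cbv beta; ring].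
  - destruct (smooth_derive phi Hp) as [Hp' _].
    split; [|split].
    + intros e t. apply (continuity_1d_2d_pt_comp sin); [apply continuity_sin | now apply Hangle].
    + exists (fun e t => phi t * cos (e * phi t)).
      split; [apply (smooth2_mult (fun _ t => phi t)); [now apply smooth2_time | now apply smooth2_cos]|].
      intros e t. exact (derive_sin_comp (fun z => z * phi t) e _ (De (phi t) e)).
    + exists (fun e t => (e * Derive phi t) * cos (e * phi t)).
      split; [apply (smooth2_mult (fun e t => e * Derive phi t)); [|now apply smooth2_cos]|].
      * apply (smooth2_mult (fun e _ => e)); [apply smooth2_param | now apply smooth2_time].
      * intros e t. exact (derive_sin_comp (fun z => e * phi z) t _ (Dt phi e t Hp)).
Qed.

(** * Vector algebra and derivatives of curves *)

Definition zerov : vec := (0, 0, 0).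

Ltac destruct_vecs :=
  repeat match goal with u : vec |- _ => destruct u as [[? ?] ?] end.

Ltac vec_unfold :=
  unfold zerov, cross, dot, vadd, vsub, vscal, c1, c2, c3 in *; cbn [fst snd] in *.

Lemma vec_ext (u w : vec) : c1 u = c1 w -> c2 u = c2 w -> c3 u = c3 w -> u = w.
Proof. destruct_vecs; vec_unfold. now intros -> -> ->. Qed.

Ltac vec_ring := intros; destruct_vecs; first [apply vec_ext | idtac];
  unfold zerov, cross, dot, vadd, vsub, vscal, c1, c2, c3; cbn [fst snd]; ring.

Lemma dot_comm (u w : vec) : dot u w = dot w u.
Proof. vec_ring. Qed.

Lemma dot_add_l (u u' w : vec) : dot (u + u')%vec w = dot u w + dot u' w.
Proof. vec_ring. Qed.

Lemma dot_sub_l (u u' w : vec) : dot (u - u')%vec w = dot u w - dot u' w.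
Proof. vec_ring. Qed.

Lemma dot_scal_l (k : R) (u w : vec) : dot (k * u)%vec w = k * dot u w.
Proof. vec_ring. Qed.

Lemma dot_add_r (u w w' : vec) : dot u (w + w')%vec = dot u w + dot u w'.
Proof. vec_ring. Qed.

Lemma dot_sub_r (u w w' : vec) : dot u (w - w')%vec = dot u w - dot u w'.
Proof. vec_ring. Qed.

Lemma dot_scal_r (k : R) (u w : vec) : dot u (k * w)%vec = k * dot u w.
Proof. vec_ring. Qed.

Lemma dot_zero_l (u : vec) : dot zerov u = 0.
Proof. vec_ring. Qed.

Ltac dot_expand := rewrite ?dot_add_l, ?dot_sub_l, ?dot_scal_l, ?dot_add_r,
  ?dot_sub_r, ?dot_scal_r, ?dot_zero_l.

Lemma dot_self_nonneg (u : vec) : 0 <= dot u u.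
Proof. destruct_vecs; vec_unfold. nra. Qed.

Lemma dot_self_zero (u : vec) : dot u u = 0 -> u = zerov.
Proof.
  destruct u as [[a b] c]. vec_unfold. intros H.
  assert (a = 0) by nra. assert (b = 0) by nra. assert (c = 0) by nra. now subst.
Qed.

Lemma vec_eq_of_dot (u w : vec) : dot (u - w)%vec (u - w)%vec = 0 -> u = w.
Proof.
  intros H%dot_self_zero. destruct u as [[u1 u2] u3], w as [[w1 w2] w3]. vec_unfold.
  injection H as H1 H2 H3. apply vec_ext; vec_unfold; lra.
Qed.

Lemma vnorm_one (u : vec) : vnorm u = 1 <-> dot u u = 1.
Proof.
  unfold vnorm. split; intros H; [|rewrite H; apply sqrt_1].
  rewrite <- (sqrt_sqrt (dot u u)) by apply dot_self_nonneg. rewrite H. ring.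
Qed.

Definition is_vderive (f : R -> vec) (t : R) (l : vec) : Prop :=
  is_derive (fun s => c1 (f s)) t (c1 l) /\
  is_derive (fun s => c2 (f s)) t (c2 l) /\
  is_derive (fun s => c3 (f s)) t (c3 l).

Lemma is_vderive_unique (f : R -> vec) (t : R) (l : vec) :
  is_vderive f t l -> vderive f t = l.
Proof.
  intros [H1 [H2 H3]]. apply vec_ext; now apply is_derive_unique.
Qed.

Lemma is_vderive_eq (f : R -> vec) (t : R) (l l' : vec) :
  is_vderive f t l -> l = l' -> is_vderive f t l'.
Proof. now intros H <-. Qed.

Lemma is_vderive_ext (f g : R -> vec) (t : R) (l : vec) :
  (forall s, f s = g s) -> is_vderive f t l -> is_vderive g t l.
Proof.
  intros E H. replace g with f; trivial. now apply functional_extensionality.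
Qed.

Lemma vderive_add (f g : R -> vec) (t : R) (a b : vec) :
  is_vderive f t a -> is_vderive g t b -> is_vderive (fun s => f s + g s)%vec t (a + b)%vec.
Proof.
  intros [F1 [F2 F3]] [G1 [G2 G3]].
  refine (conj _ (conj _ _)); [exact (derive_plus _ _ _ _ _ F1 G1) | exact (derive_plus _ _ _ _ _ F2 G2)
    | exact (derive_plus _ _ _ _ _ F3 G3)].
Qed.

Lemma vderive_sub (f g : R -> vec) (t : R) (a b : vec) :
  is_vderive f t a -> is_vderive g t b -> is_vderive (fun s => f s - g s)%vec t (a - b)%vec.
Proof.
  intros [F1 [F2 F3]] [G1 [G2 G3]].
  refine (conj _ (conj _ _)); [exact (derive_minus _ _ _ _ _ F1 G1) | exact (derive_minus _ _ _ _ _ F2 G2)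
    | exact (derive_minus _ _ _ _ _ F3 G3)].
Qed.

Lemma vderive_const (c : vec) (t : R) : is_vderive (fun _ => c) t zerov.
Proof. refine (conj _ (conj _ _)); apply derive_const. Qed.

Lemma vderive_scal (k : R -> R) (f : R -> vec) (t k' : R) (a : vec) :
  is_derive k t k' -> is_vderive f t a ->
  is_vderive (fun s => k s * f s)%vec t (k' * f t + k t * a)%vec.
Proof.
  intros K [F1 [F2 F3]].
  refine (conj _ (conj _ _)); [exact (derive_mult _ _ _ _ _ K F1) | exact (derive_mult _ _ _ _ _ K F2)
    | exact (derive_mult _ _ _ _ _ K F3)].
Qed.

Lemma derive_dot (f g : R -> vec) (t : R) (a b : vec) :
  is_vderive f t a -> is_vderive g t b ->
  is_derive (fun s => dot (f s) (g s)) t (dot a (g t) + dot (f t) b).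
Proof.
  intros [F1 [F2 F3]] [G1 [G2 G3]].
  eapply derive_eq.
  - exact (derive_plus _ _ _ _ _ (derive_plus _ _ _ _ _ (derive_mult _ _ _ _ _ F1 G1)
      (derive_mult _ _ _ _ _ F2 G2)) (derive_mult _ _ _ _ _ F3 G3)).
  - cbv beta. unfold dot. ring.
Qed.

Lemma vderive_cross (f g : R -> vec) (t : R) (a b : vec) :
  is_vderive f t a -> is_vderive g t b ->
  is_vderive (fun s => cross (f s) (g s)) t (cross a (g t) + cross (f t) b)%vec.
Proof.
  intros [F1 [F2 F3]] [G1 [G2 G3]].
  refine (conj (derive_eq _ _ _ _ _ _) (conj (derive_eq _ _ _ _ _ _) (derive_eq _ _ _ _ _ _))).
  - exact (derive_minus _ _ _ _ _ (derive_mult _ _ _ _ _ F2 G3) (derive_mult _ _ _ _ _ F3 G2)).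
  - unfold cross, vadd, c1, c2, c3; cbn [fst snd]; ring.
  - exact (derive_minus _ _ _ _ _ (derive_mult _ _ _ _ _ F3 G1) (derive_mult _ _ _ _ _ F1 G3)).
  - unfold cross, vadd, c1, c2, c3; cbn [fst snd]; ring.
  - exact (derive_minus _ _ _ _ _ (derive_mult _ _ _ _ _ F1 G2) (derive_mult _ _ _ _ _ F2 G1)).
  - unfold cross, vadd, c1, c2, c3; cbn [fst snd]; ring.
Qed.

(** Differentiated constraints such as [|v| = 1] enter every later argument
    through this lemma. *)
Lemma derive_dot_const (f g : R -> vec) (t c : R) (a b : vec) :
  is_vderive f t a -> is_vderive g t b -> (forall s, dot (f s) (g s) = c) ->
  dot a (g t) + dot (f t) b = 0.
Proof.
  intros Hf Hg Hc. refine (derive_unique _ _ _ _ (derive_dot f g t a b Hf Hg) _).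
  apply (is_derive_ext (fun _ => c)); [now intros | apply derive_const].
Qed.

Lemma constant_of_vderive_zero (f : R -> vec) :
  (forall t, is_vderive f t zerov) -> forall s t, f s = f t.
Proof.
  intros H s t.
  apply vec_ext; [apply (constant_of_derive_zero (fun u => c1 (f u)))
    | apply (constant_of_derive_zero (fun u => c2 (f u)))
    | apply (constant_of_derive_zero (fun u => c3 (f u)))]; intros u; apply (H u).
Qed.

Lemma smooth_curve_comp (f : R -> vec) :
  smooth_curve f <-> smooth (fun s => c1 (f s)) /\ smooth (fun s => c2 (f s)) /\
                     smooth (fun s => c3 (f s)).
Proof.
  split.
  - intros H. refine (conj _ (conj _ _)); intros n t; apply H.
  - intros [H1 [H2 H3]] n t. refine (conj _ (conj _ _)); [apply H1 | apply H2 | apply H3].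
Qed.

Lemma smooth_curve_vderive (f : R -> vec) :
  smooth_curve f -> smooth_curve (vderive f) /\ forall t, is_vderive f t (vderive f t).
Proof.
  intros [H1 [H2 H3]]%smooth_curve_comp.
  apply smooth_derive in H1 as [H1 D1]. apply smooth_derive in H2 as [H2 D2].
  apply smooth_derive in H3 as [H3 D3].
  split; [now apply smooth_curve_comp|]. intros t. refine (conj _ (conj _ _)); auto.
Qed.

Lemma smooth_dot (f g : R -> vec) :
  smooth_curve f -> smooth_curve g -> smooth (fun t => dot (f t) (g t)).
Proof.
  intros [F1 [F2 F3]]%smooth_curve_comp [G1 [G2 G3]]%smooth_curve_comp.
  unfold dot. apply smooth_plus; [apply smooth_plus|]; now apply smooth_mult.
Qed.

Lemma smooth_curve_sub (f g : R -> vec) :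
  smooth_curve f -> smooth_curve g -> smooth_curve (fun t => f t - g t)%vec.
Proof.
  intros [F1 [F2 F3]]%smooth_curve_comp [G1 [G2 G3]]%smooth_curve_comp.
  apply smooth_curve_comp. refine (conj _ (conj _ _)); now apply smooth_minus.
Qed.

Lemma smooth_curve_cross (f g : R -> vec) :
  smooth_curve f -> smooth_curve g -> smooth_curve (fun t => cross (f t) (g t)).
Proof.
  intros [F1 [F2 F3]]%smooth_curve_comp [G1 [G2 G3]]%smooth_curve_comp.
  apply smooth_curve_comp. refine (conj _ (conj _ _)); apply smooth_minus; now apply smooth_mult.
Qed.

Lemma smooth_curve_const (c : vec) : smooth_curve (fun _ => c).
Proof. apply smooth_curve_comp. refine (conj _ (conj _ _)); apply smooth_const. Qed.

Definition vsmooth2 (F : R -> R -> vec) : Prop :=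
  smooth2 (fun e t => c1 (F e t)) /\ smooth2 (fun e t => c2 (F e t)) /\
  smooth2 (fun e t => c3 (F e t)).

Lemma vsmooth2_family (F : R -> R -> vec) (delta : R) : vsmooth2 F -> smooth_family delta F.
Proof.
  intros [H1 [H2 H3]] n e t _. refine (conj _ (conj _ _)); now apply smooth2_ex_diff_n.
Qed.

Lemma vsmooth2_curve (f : R -> vec) : smooth_curve f -> vsmooth2 (fun _ t => f t).
Proof.
  intros [H1 [H2 H3]]%smooth_curve_comp.
  split; [|split]; [exact (smooth2_time _ H1) | exact (smooth2_time _ H2)
    | exact (smooth2_time _ H3)].
Qed.

Lemma vsmooth2_add (F G : R -> R -> vec) :
  vsmooth2 F -> vsmooth2 G -> vsmooth2 (fun e t => F e t + G e t)%vec.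
Proof.
  intros [F1 [F2 F3]] [G1 [G2 G3]]. refine (conj _ (conj _ _)); [exact (smooth2_plus _ _ F1 G1)
   | exact (smooth2_plus _ _ F2 G2) | exact (smooth2_plus _ _ F3 G3)].
Qed.

Lemma vsmooth2_scal (k : R -> R -> R) (F : R -> R -> vec) :
  smooth2 k -> vsmooth2 F -> vsmooth2 (fun e t => k e t * F e t)%vec.
Proof.
  intros K [F1 [F2 F3]]. refine (conj _ (conj _ _)); [exact (smooth2_mult _ _ K F1)
   | exact (smooth2_mult _ _ K F2) | exact (smooth2_mult _ _ K F3)].
Qed.

(** * The first variation of length *)

(** The tangent of the square root at 1.  It replaces differentiation under the
    integral sign: a quadratic upper bound for the length is enough to use that
    the length is critical. *)
Lemma sqrt_le_linear (z : R) : 0 <= z -> sqrt z <= (1 + z) / 2.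
Proof.
  intros Hz. assert (H := sqrt_sqrt z Hz). assert (0 <= (sqrt z - 1) * (sqrt z - 1)) by apply Rle_0_sqr.
  nra.
Qed.

Lemma derive_zero_at_minimum (f : R -> R) (l : R) :
  is_derive f 0 l -> (forall e, -1 < e < 1 -> f 0 <= f e) -> l = 0.
Proof.
  intros Hf Hmin. apply is_derive_Reals in Hf.
  refine (eq_trans _ (deriv_minimum f (-1) 1 0 (exist _ l Hf) _ _ _)).
  - reflexivity.
  - lra.
  - lra.
  - intros; now apply Hmin.
Qed.

(** When the squared speed is [1 + 2 e A + e^2 B], the length is at most
    [Q(e) = (t1 - t0) + e int A + e^2/2 int B], with equality at [e = 0].  So
    [Q - length] is minimal at 0; as the length has derivative 0 there, the
    linear coefficient [int A] of [Q] vanishes.  The integrals are expressed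
    by the primitives [FA] and [FB]. *)
Lemma first_variation (x y : R -> vec) (t0 t1 : R) (X Y : R -> R -> vec)
    (A B FA FB : R -> R) :
  t0 < t1 -> critical_between x y t0 t1 -> variation x y t0 t1 1 X Y ->
  (forall t, continuous A t) -> (forall t, continuous B t) ->
  (forall t, is_derive FA t (A t)) -> (forall t, is_derive FB t (B t)) ->
  (forall e t, dot (vderive (X e) t) (vderive (X e) t) = 1 + 2 * e * A t + e ^ 2 * B t) ->
  FA t1 = FA t0.
Proof.
  intros Ht Hcrit Hvar CA CB DA DB Hspeed.
  assert (HL := Hcrit 1 X Y Hvar). clear Hcrit Hvar.
  set (L := fun e => front_length (X e) t0 t1) in HL.
  assert (Hpoly : forall e t, continuous (fun s => 1 + 2 * e * A s + e ^ 2 * B s) t).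
  { intros e t. apply (continuous_plus (fun s => 1 + 2 * e * A s) (fun s => e ^ 2 * B s)).
    - apply (continuous_plus (fun s => 1) (fun s => 2 * e * A s)); [apply continuous_const|].
      apply (continuous_scal_r (2 * e) A), CA.
    - apply (continuous_scal_r (e ^ 2) B), CB. }
  set (Q := fun e => (t1 - t0) + e * (FA t1 - FA t0) + e ^ 2 / 2 * (FB t1 - FB t0)).
  assert (HQ : forall e, is_RInt (fun t => (1 + (1 + 2 * e * A t + e ^ 2 * B t)) / 2) t0 t1 (Q e)).
  { intros e. set (P := fun t => t + (e * FA t + e ^ 2 / 2 * FB t)).
    replace (Q e) with (minus (P t1) (P t0)).
    - apply (is_RInt_derive P).
      + intros t _. eapply derive_eq.
        * apply derive_plus; [apply @is_derive_id|].
          apply derive_plus; apply is_derive_scal; [apply DA | apply DB].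
        * unfold one; simpl; field.
      + intros t _.
        exact (continuous_scal_l _ (/ 2) t (continuous_plus (fun _ => 1) _ t
                 (continuous_const _ _) (Hpoly e t))).
    - unfold P, Q, minus, plus, opp; cbn. lra. }
  assert (Hle : forall e, L e <= Q e).
  { intros e. unfold L, front_length.
    rewrite <- (is_RInt_unique _ _ _ _ (HQ e)).
    apply RInt_le; [lra | | now exists (Q e) | ].
    - apply (@ex_RInt_continuous R_CompleteNormedModule). intros t _. unfold vnorm.
      apply continuous_sqrt_comp.
      apply (continuous_ext (fun s => 1 + 2 * e * A s + e ^ 2 * B s)); [|apply Hpoly].
      intros s; now rewrite Hspeed.
    - intros t _. unfold vnorm. rewrite <- Hspeed. apply sqrt_le_linear, dot_self_nonneg. }
  assert (H0 : L 0 = Q 0).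
  { transitivity (t1 - t0).
    - unfold L, front_length. apply is_RInt_unique.
      apply (is_RInt_ext (fun _ => 1)).
      + intros t _. unfold vnorm. rewrite Hspeed.
        replace (1 + 2 * 0 * A t + 0 ^ 2 * B t) with 1 by ring. now rewrite sqrt_1.
      + replace (t1 - t0) with (scal (t1 - t0) 1); [apply @is_RInt_const|].
        unfold scal; simpl; unfold mult; simpl; ring.
    - unfold Q. field. }
  enough (FA t1 - FA t0 = 0) by lra.
  apply (derive_zero_at_minimum (fun e => Q e - L e)).
  - replace (FA t1 - FA t0) with ((FA t1 - FA t0) - 0) by ring.
    apply derive_minus; [|exact HL].
    unfold Q. auto_derive; trivial. field.
  - intros e _. rewrite H0. specialize (Hle e). lra.
Qed.

(** * Variations of a bicycling geodesic *)

Definition rod (x y : R -> vec) (t : R) : vec := (x t - y t)%vec.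

(** Signed speed of the back wheel: [y' = roll * rod], see [path_vderive]. *)
Definition roll (x y : R -> vec) (t : R) : R := dot (rod x y t) (vderive x t).

Lemma rod_unit (x y : R -> vec) : bicycle_path x y -> forall t, dot (rod x y t) (rod x y t) = 1.
Proof. intros [_ [_ H]] t. apply vnorm_one, H. Qed.

(** The factor in [y' = k v] is identified by pairing [x' = k v + v'] with [v],
    since [v . v' = 0]. *)
Lemma path_vderive (x y : R -> vec) : bicycle_path x y -> forall t,
  is_vderive x t (vderive x t) /\
  is_vderive y t (roll x y t * rod x y t)%vec /\
  is_vderive (rod x y) t (vderive x t - roll x y t * rod x y t)%vec.
Proof.
  intros Hp t. assert (Hu := rod_unit x y Hp).
  destruct Hp as [Sx [Sy H]].
  assert (Dx := proj2 (smooth_curve_vderive x Sx) t).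
  assert (Dy := proj2 (smooth_curve_vderive y Sy) t).
  destruct (H t) as [_ [k Hk]]. fold (rod x y t) in Hk. rewrite Hk in Dy.
  assert (Dv := vderive_sub x y t _ _ Dx Dy).
  assert (H0 := derive_dot_const _ _ t 1 _ _ Dv Dv Hu). cbv beta in H0.
  fold (rod x y t) in H0.
  assert (Ek : roll x y t = k).
  { revert H0. unfold roll. dot_expand. rewrite (dot_comm (vderive x t)), Hu. lra. }
  rewrite Ek. auto.
Qed.

Lemma smooth_rod (x y : R -> vec) : bicycle_path x y -> smooth_curve (rod x y).
Proof. intros [Sx [Sy _]]. now apply smooth_curve_sub. Qed.

Lemma smooth_roll (x y : R -> vec) : bicycle_path x y -> smooth (roll x y).
Proof.
  intros Hp. apply smooth_dot; [now apply smooth_rod|].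
  apply smooth_curve_vderive, Hp.
Qed.

Lemma unit_speed_dot (x : R -> vec) :
  unit_speed x -> forall t, dot (vderive x t) (vderive x t) = 1.
Proof. intros H t. apply vnorm_one, H. Qed.

(** Adding [e W] to both wheels keeps the rod, and [W' = kappa v] keeps the back
    wheel rolling along it.  The varied front speed is [x' + e kappa v], of
    squared length [1 + 2 e kappa k + e^2 kappa^2]; so [int kappa k = 0]. *)
Lemma rolling_variation (x y : R -> vec) (t0 t1 : R) (kappa F : R -> R) (W : R -> vec) :
  bicycling_geodesic x y -> t0 < t1 -> smooth kappa -> smooth_curve W ->
  (forall t, is_vderive W t (kappa t * rod x y t)%vec) ->
  W t0 = zerov -> W t1 = zerov ->
  (forall t, is_derive F t (kappa t * roll x y t)) ->
  F t1 = F t0.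
Proof.
  intros [Hp [Hs Hcrit]] Ht Sk SW DW W0 W1 DF.
  assert (Hu := rod_unit x y Hp). assert (Hd := path_vderive x y Hp).
  destruct (smooth_primitive (fun t => kappa t * kappa t) 0) as [FB [_ [_ [DB _]]]];
    [now apply smooth_mult|].
  set (X := fun (z : R -> vec) e t => (z t + e * W t)%vec).
  assert (DX : forall z e t l, is_vderive z t l ->
             is_vderive (X z e) t (l + (e * kappa t) * rod x y t)%vec).
  { intros z e t l Hz. eapply is_vderive_eq.
    - apply vderive_add; [exact Hz|]. apply vderive_scal; [apply derive_const | apply DW].
    - f_equal. vec_ring. }
  assert (SX : forall z, smooth_curve z -> vsmooth2 (X z)).
  { intros z Hz. apply (vsmooth2_add (fun _ t => z t)); [now apply vsmooth2_curve|].
    apply (vsmooth2_scal (fun e _ => e) (fun _ t => W t)); [apply smooth2_param|].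
    now apply vsmooth2_curve. }
  assert (E0 : forall z t, X z 0 t = z t) by (intros; unfold X; vec_ring).
  assert (Eend : forall z e t, W t = zerov -> X z e t = z t)
    by (intros z e t E; unfold X; rewrite E; vec_ring).
  assert (Erod : forall e t, (X x e t - X y e t)%vec = rod x y t)
    by (intros; unfold X, rod; vec_ring).
  apply (first_variation x y t0 t1 (X x) (X y) (fun t => kappa t * roll x y t)
           (fun t => kappa t * kappa t) F FB); trivial.
  - now apply Hcrit.
  - split; try lra; try (apply vsmooth2_family, SX; apply Hp).
    + intros; split; apply E0.
    + intros e t _ _. split.
      * apply vnorm_one. now rewrite Erod.
      * exists (roll x y t + e * kappa t). rewrite Erod.
        apply is_vderive_unique. eapply is_vderive_eq; [exact (DX y e t _ (proj1 (proj2 (Hd t)))) | vec_ring].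
    + intros; split; now apply Eend.
    + intros; split; now apply Eend.
  - apply smooth_continuous, smooth_mult; trivial. now apply smooth_roll.
  - apply smooth_continuous. now apply smooth_mult.
  - intros e t. rewrite (is_vderive_unique _ _ _ (DX x e t _ (proj1 (Hd t)))).
    dot_expand. rewrite (dot_comm (vderive x t) (rod x y t)).
    fold (roll x y t). rewrite Hu, (unit_speed_dot x Hs). ring.
Qed.

(** Rodrigues' formula: for a unit vector [u], the rotation by the angle [a]
    about [u]. *)
Definition rotation (u : vec) (a : R) (w : vec) : vec :=
  (w + sin a * cross u w + (1 - cos a) * cross u (cross u w))%vec.

Lemma rotation_isometry (u : vec) (a : R) (w z : vec) :
  dot u u = 1 -> dot (rotation u a w) (rotation u a z) = dot w z.
Proof.
  intros Hu. assert (Ha := sin2_cos2 a). unfold Rsqr in Ha. unfold rotation.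
  generalize dependent (sin a). generalize dependent (cos a). intros C S Ha.
  destruct u as [[u1 u2] u3], w as [[w1 w2] w3], z as [[z1 z2] z3]. vec_unfold.
  assert (E1 : S * S = 1 - C * C) by lra. assert (E2 : u3 * u3 = 1 - u1 * u1 - u2 * u2) by lra.
  ring [E1 E2].
Qed.

Lemma rotation_zero (u w : vec) : rotation u 0 w = w.
Proof. unfold rotation. rewrite sin_0, cos_0. vec_ring. Qed.

(** The derivative of the rotation in its angle is the rotation of the angular
    velocity field [u x w]; for unit [u] this rests on
    [u x (u x (u x w)) = - u x w]. *)
Lemma vderive_rotation (u : vec) (phi : R -> R) (w : R -> vec) (t phi' : R) (w' : vec) :
  dot u u = 1 -> is_derive phi t phi' -> is_vderive w t w' ->
  is_vderive (fun s => rotation u (phi s) (w s)) t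
    (rotation u (phi t) (w' + phi' * cross u (w t)))%vec.
Proof.
  intros Hu Dphi Dw. unfold rotation.
  assert (Dc : is_vderive (fun s => cross u (w s)) t (cross u w')).
  { eapply is_vderive_eq; [apply vderive_cross; [apply vderive_const | exact Dw]|].
    generalize (w t). vec_ring. }
  assert (Dcc : is_vderive (fun s => cross u (cross u (w s))) t (cross u (cross u w'))).
  { eapply is_vderive_eq; [apply vderive_cross; [apply vderive_const | exact Dc]|].
    generalize (w t). vec_ring. }
  eapply is_vderive_eq.
  - apply vderive_add; [apply vderive_add|].
    + exact Dw.
    + apply vderive_scal; [exact (derive_sin_comp _ _ _ Dphi) | exact Dc].
    + apply (vderive_scal (fun s => 1 - cos (phi s)));
        [exact (derive_minus _ _ _ _ _ (derive_const 1 t) (derive_cos_comp _ _ _ Dphi)) | exact Dcc].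
  - cbv beta. generalize (sin (phi t)) (cos (phi t)) (w t). intros S C z.
    destruct u as [[u1 u2] u3], w' as [[w1 w2] w3], z as [[z1 z2] z3].
    assert (E2 : u3 * u3 = 1 - u1 * u1 - u2 * u2) by (vec_unfold; lra).
    apply vec_ext; vec_unfold; ring [E2].
Qed.

(** With the back wheel at rest, any motion of the rod is a bicycle path.
    Turning the rod by the angle [e phi(t)] about [u] makes the front speed a
    rotated copy of [v' + e phi' u x v], of squared length
    [1 + 2 e phi' u . (v x v') + e^2 phi'^2 |u x v|^2]. *)
Lemma turning_variation (x y : R -> vec) (u : vec) (t0 t1 : R) (phi F : R -> R) :
  bicycling_geodesic x y -> (forall t, roll x y t = 0) -> t0 < t1 -> dot u u = 1 ->
  smooth phi -> phi t0 = 0 -> phi t1 = 0 ->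
  (forall t, is_derive F t (Derive phi t * dot u (cross (rod x y t) (vderive x t)))) ->
  F t1 = F t0.
Proof.
  intros [Hp [Hs Hcrit]] Hroll Ht Hu Sphi Phi0 Phi1 DF.
  assert (Hv := rod_unit x y Hp). assert (Hd := path_vderive x y Hp).
  destruct (smooth_derive phi Sphi) as [Sphi' Dphi].
  assert (Srod := smooth_rod x y Hp).
  assert (Sx' := proj1 (smooth_curve_vderive x (proj1 Hp))).
  assert (Suv : smooth_curve (fun t => cross u (rod x y t)))
    by (apply (smooth_curve_cross (fun _ => u)); [apply smooth_curve_const | trivial]).
  assert (Suuv : smooth_curve (fun t => cross u (cross u (rod x y t))))
    by (apply (smooth_curve_cross (fun _ => u)); [apply smooth_curve_const | trivial]).
  assert (Dy : forall t, is_vderive y t zerov).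
  { intros t. eapply is_vderive_eq; [exact (proj1 (proj2 (Hd t)))|]. rewrite Hroll. vec_ring. }
  assert (Dv : forall t, is_vderive (rod x y) t (vderive x t)).
  { intros t. eapply is_vderive_eq; [exact (proj2 (proj2 (Hd t)))|]. rewrite Hroll. vec_ring. }
  set (B := fun t => Derive phi t * Derive phi t
                     * dot (cross u (rod x y t)) (cross u (rod x y t))).
  assert (SB : smooth B).
  { apply smooth_mult; [now apply smooth_mult | now apply smooth_dot]. }
  destruct (smooth_primitive B 0 SB) as [FB [_ [_ [DB _]]]].
  set (X := fun e t => (y t + rotation u (e * phi t) (rod x y t))%vec).
  assert (DX : forall e t, is_vderive (X e) t
      (rotation u (e * phi t) (vderive x t + (e * Derive phi t) * cross u (rod x y t)))%vec).
  { intros e t. eapply is_vderive_eq.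
    - apply vderive_add; [apply Dy|].
      apply (vderive_rotation u (fun s => e * phi s)); trivial.
      apply is_derive_scal, Dphi.
    - vec_ring. }
  assert (SX : vsmooth2 X).
  { unfold X, rotation. apply (vsmooth2_add (fun _ t => y t)); [apply vsmooth2_curve, Hp|].
    apply vsmooth2_add; [apply (vsmooth2_add (fun _ t => rod x y t))|].
    - now apply vsmooth2_curve.
    - apply (vsmooth2_scal _ (fun _ t => cross u (rod x y t)));
        [now apply smooth2_sin | now apply vsmooth2_curve].
    - apply (vsmooth2_scal (fun e t => 1 - cos (e * phi t))
               (fun _ t => cross u (cross u (rod x y t)))); [|now apply vsmooth2_curve].
      replace (fun e t => 1 - cos (e * phi t)) with (fun e t => 1 + (-1) * cos (e * phi t))
        by (do 2 (apply functional_extensionality; intro); ring).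
      apply (smooth2_plus (fun _ _ => 1)); [apply smooth2_const|].
      apply (smooth2_mult (fun _ _ => -1)); [apply smooth2_const | now apply smooth2_cos]. }
  assert (EX : forall e t, e * phi t = 0 -> X e t = x t).
  { intros e t E. unfold X. rewrite E, rotation_zero. unfold rod. vec_ring. }
  assert (Erod : forall e t, (X e t - y t)%vec = rotation u (e * phi t) (rod x y t))
    by (intros; unfold X; vec_ring).
  apply (first_variation x y t0 t1 X (fun _ t => y t)
           (fun t => Derive phi t * dot u (cross (rod x y t) (vderive x t))) B F FB); trivial.
  - now apply Hcrit.
  - split; try lra.
    + now apply vsmooth2_family.
    + apply (vsmooth2_family (fun _ t => y t)), vsmooth2_curve, Hp.
    + intros; split; trivial. apply EX. ring.
    + intros e t _ _. split.
      * apply vnorm_one. now rewrite Erod, rotation_isometry.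
      * exists 0. transitivity zerov; [apply is_vderive_unique, Dy|]. vec_ring.
    + intros; split; trivial. apply EX. rewrite Phi0; ring.
    + intros; split; trivial. apply EX. rewrite Phi1; ring.
  - apply smooth_continuous, smooth_mult; trivial.
    apply (smooth_dot (fun _ => u)); [apply smooth_curve_const | now apply smooth_curve_cross].
  - now apply smooth_continuous.
  - intros e t. rewrite (is_vderive_unique _ _ _ (DX e t)), rotation_isometry; trivial.
    unfold B. assert (H1 := unit_speed_dot x Hs t). revert H1.
    generalize (vderive x t) (rod x y t) (Derive phi t). intros a b d H1.
    transitivity (dot a a + 2 * e * (d * dot u (cross b a)) + e ^ 2 * (d * d * dot (cross u b) (cross u b)));
      [vec_ring | rewrite H1; ring].
Qed.

(** * Harmonic motion and spinning about a fixed back wheel *)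

Lemma gram_identity (u v w : vec) :
  dot u (cross v w) ^ 2
  = dot u u * dot v v * dot w w + 2 * dot u v * dot v w * dot w u
    - dot u u * dot v w ^ 2 - dot v v * dot w u ^ 2 - dot w w * dot u v ^ 2.
Proof. vec_ring. Qed.

Lemma orthonormal_span (a b z : vec) :
  dot a a = 1 -> dot b b = 1 -> dot a b = 0 -> dot (cross a b) z = 0 ->
  z = (dot z a * a + dot z b * b)%vec.
Proof.
  intros Ha Hb Hab Hz. apply vec_eq_of_dot.
  assert (G := gram_identity z a b).
  rewrite (dot_comm z (cross a b)), (dot_comm b z), Hz, Ha, Hb, Hab in G.
  set (k := dot z a) in *. set (l := dot z b) in *.
  transitivity (dot z z - 2 * k * dot z a - 2 * l * dot z b + k ^ 2 * dot a a
                + l ^ 2 * dot b b + 2 * k * l * dot a b).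
  - generalize k l. vec_ring.
  - rewrite Ha, Hb, Hab. fold k l. lra.
Qed.

(** An orthonormal triple has triple product [+1] or [-1], and the triple product
    times [w] is a combination of the three vanishing coordinates of [w]. *)
Lemma zero_of_orthonormal (a b c w : vec) :
  dot a a = 1 -> dot b b = 1 -> dot c c = 1 ->
  dot a b = 0 -> dot b c = 0 -> dot c a = 0 ->
  dot w a = 0 -> dot w b = 0 -> dot w c = 0 -> w = zerov.
Proof.
  intros Ha Hb Hc Hab Hbc Hca H1 H2 H3. apply dot_self_zero.
  assert (G := gram_identity a b c). rewrite Ha, Hb, Hc, Hab, Hbc, Hca in G.
  assert (E : dot a (cross b c) * dot w w
              = dot w a * dot w (cross b c) + dot w b * dot w (cross c a)
                + dot w c * dot w (cross a b)) by vec_ring.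
  rewrite H1, H2, H3 in E. nra.
Qed.

(** The difference from the claimed solution solves the same equation with zero
    initial data, and its energy is conserved. *)
Lemma harmonic_motion (f g : R -> R) :
  (forall t, is_derive f t (g t)) -> (forall t, is_derive g t (- f t)) ->
  forall t, f t = f 0 * cos t + g 0 * sin t.
Proof.
  intros Df Dg t.
  set (d := fun t => f t - (f 0 * cos t + g 0 * sin t)).
  set (h := fun t => g t - (g 0 * cos t - f 0 * sin t)).
  assert (Dd : forall t, is_derive d t (h t)).
  { intros s. eapply derive_eq.
    - apply derive_minus; [apply Df|].
      apply derive_plus; apply is_derive_scal; [apply is_derive_cos | apply is_derive_sin].
    - unfold h. ring. }
  assert (Dh : forall t, is_derive h t (- d t)).
  { intros s. eapply derive_eq.
    - apply derive_minus; [apply Dg|].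
      apply derive_minus; apply is_derive_scal; [apply is_derive_cos | apply is_derive_sin].
    - unfold d. ring. }
  assert (E : d t * d t + h t * h t = d 0 * d 0 + h 0 * h 0).
  { apply (constant_of_derive_zero (fun s => d s * d s + h s * h s)). intros s.
    eapply derive_eq; [apply derive_plus; apply derive_mult; trivial | cbv beta; ring]. }
  assert (d 0 = 0) by (unfold d; rewrite cos_0, sin_0; ring).
  assert (h 0 = 0) by (unfold h; rewrite cos_0, sin_0; ring).
  assert (d t = 0) by nra. unfold d in *. lra.
Qed.

Lemma harmonic_curve (f g : R -> vec) :
  (forall t, is_vderive f t (g t)) -> (forall t, is_vderive g t (-1 * f t)%vec) ->
  forall t, f t = (cos t * f 0 + sin t * g 0)%vec.
Proof.
  intros Df Dg t.
  apply vec_ext; [pose proof (harmonic_motion (fun s => c1 (f s)) (fun s => c1 (g s))) as H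
    | pose proof (harmonic_motion (fun s => c2 (f s)) (fun s => c2 (g s))) as H
    | pose proof (harmonic_motion (fun s => c3 (f s)) (fun s => c3 (g s))) as H];
  cbv beta in H; rewrite H;
    try (intros s; first [exact (proj1 (Df s)) | exact (proj1 (proj2 (Df s)))
                         | exact (proj2 (proj2 (Df s)))]);
    try (intros s; eapply derive_eq; [first [exact (proj1 (Dg s)) | exact (proj1 (proj2 (Dg s)))
                         | exact (proj2 (proj2 (Dg s)))] |]);
  unfold vadd, vscal, c1, c2, c3; cbn [fst snd]; ring.
Qed.

Lemma harmonic_periodic (f g : R -> vec) :
  (forall t, is_vderive f t (g t)) -> (forall t, is_vderive g t (-1 * f t)%vec) ->
  forall t, f (t + 2 * PI) = f t.
Proof.
  intros Df Dg t. rewrite (harmonic_curve f g Df Dg (t + 2 * PI)), (harmonic_curve f g Df Dg t).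
  replace (t + 2 * PI) with (t + 2 * INR 1 * PI) by (simpl; ring).
  now rewrite cos_period, sin_period.
Qed.

(** The motion common to all the conditions: the front wheel circles at unit
    speed about the resting back wheel. *)
Definition spins (x y : R -> vec) : Prop :=
  forall t, is_vderive y t zerov /\ is_vderive (rod x y) t (vderive x t) /\
            is_vderive (vderive x) t (-1 * rod x y t)%vec.

Lemma spins_closed (x y : R -> vec) : spins x y -> closed_path x y.
Proof.
  intros H. exists (2 * PI). split; [assert (H0 := PI_RGT_0); lra|]. intros t.
  assert (Ey : y (t + 2 * PI) = y t) by (apply constant_of_vderive_zero; apply H).
  assert (Ev : rod x y (t + 2 * PI) = rod x y t)
    by (apply (harmonic_periodic _ (vderive x)); apply H).
  split; trivial.
  transitivity (y (t + 2 * PI)%R + rod x y (t + 2 * PI)%R)%vec; [unfold rod; vec_ring|].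
  rewrite Ey, Ev. unfold rod. vec_ring.
Qed.

Lemma angle_exists (a b : R) : a * a + b * b = 1 -> exists t, cos t = a /\ sin t = b.
Proof.
  intros H. assert (Ha : -1 <= a <= 1) by nra.
  assert (Hs : sqrt (1 - a²) = Rabs b).
  { rewrite <- sqrt_Rsqr_abs. f_equal. unfold Rsqr. lra. }
  destruct (Rle_dec 0 b).
  - exists (acos a). rewrite cos_acos, sin_acos, Hs, Rabs_right; auto; lra.
  - exists (- acos a). rewrite cos_neg, sin_neg, cos_acos, sin_acos, Hs, Rabs_left; auto; lra.
Qed.

Lemma spins_orthogonal (x y : R -> vec) :
  bicycle_path x y -> spins x y -> forall t, dot (rod x y t) (vderive x t) = 0.
Proof.
  intros Hp H t. destruct (H t) as [_ [Dv _]].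
  assert (E := derive_dot_const _ _ t 1 _ _ Dv Dv (rod_unit x y Hp)). cbv beta in E.
  rewrite dot_comm in E. lra.
Qed.

(** The centre is the resting back wheel, and the plane of the circle is spanned
    by the initial rod and the initial velocity. *)
Lemma spins_track (x y : R -> vec) :
  bicycle_path x y -> unit_speed x -> spins x y -> track_is_unit_circle x.
Proof.
  intros Hp Hs H.
  assert (Hv := rod_unit x y Hp). assert (Hw := unit_speed_dot x Hs).
  assert (Hvw := spins_orthogonal x y Hp H).
  assert (Ex : forall t, (x t - y 0)%vec = rod x y t).
  { intros t. rewrite (constant_of_vderive_zero y (fun s => proj1 (H s)) 0 t). reflexivity. }
  assert (Ev := harmonic_curve (rod x y) (vderive x) (fun s => proj1 (proj2 (H s)))
                  (fun s => proj2 (proj2 (H s)))).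
  exists (y 0), (cross (rod x y 0) (vderive x 0)). split.
  { apply vnorm_one.
    transitivity (dot (rod x y 0) (rod x y 0) * dot (vderive x 0) (vderive x 0)
                  - dot (rod x y 0) (vderive x 0) ^ 2);
      [generalize (rod x y 0) (vderive x 0); vec_ring | rewrite Hv, Hw, Hvw; ring]. }
  intros q. split.
  - intros [t <-]. rewrite Ex. split; [now apply vnorm_one|]. rewrite (Ev t).
    generalize (rod x y 0) (vderive x 0). vec_ring.
  - intros [Hq Hn]. apply vnorm_one in Hq.
    assert (E := orthonormal_span _ _ _ (Hv 0) (Hw 0) (Hvw 0) Hn).
    set (a := dot (q - y 0)%vec (rod x y 0)) in *.
    set (b := dot (q - y 0)%vec (vderive x 0)) in *.
    destruct (angle_exists a b) as [t [Ha Hb]].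
    { rewrite E in Hq. revert Hq. dot_expand.
      rewrite (dot_comm (vderive x 0) (rod x y 0)), Hv, Hw, Hvw. lra. }
    exists t.
    transitivity (y 0 + (x t - y 0))%vec; [vec_ring|].
    rewrite Ex, (Ev t), Ha, Hb, <- E. vec_ring.
Qed.

Lemma spins_geodesic_equations (x y : R -> vec) :
  bicycle_path x y -> unit_speed x -> spins x y ->
  geodesic_equations x y zerov (vderive x) /\ param_a x y zerov = 0.
Proof.
  intros Hp Hs H. assert (Hw := unit_speed_dot x Hs). split.
  - split.
    + apply smooth_curve_vderive, Hp.
    + intros t. vec_ring.
    + intros t v.
      change (vderive (rod x y) t
              = (zerov + vderive x t - dot (rod x y t) zerov * rod x y t)%vec).
      rewrite (is_vderive_unique _ _ _ (proj1 (proj2 (H t)))).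
      rewrite (dot_comm _ zerov), dot_zero_l. vec_ring.
    + intros t v. rewrite (is_vderive_unique _ _ _ (proj2 (proj2 (H t)))).
      unfold v. fold (rod x y t). rewrite (dot_comm _ zerov), dot_zero_l. dot_expand.
      rewrite (dot_comm _ zerov), dot_zero_l, Hw. vec_ring.
    + intros t. apply vnorm_one, (rod_unit x y Hp).
    + intros t. rewrite dot_comm. now apply spins_orthogonal.
    + exact Hs.
  - unfold param_a, param_b. rewrite !dot_zero_l.
    replace (0 - 0 ^ 2) with 0 by ring. apply sqrt_0.
Qed.

(** * The geodesic equations *)

(** The rolling speed of a solution is [v . p], because [x' = p + r] and
    [r . v = 0]. *)
Lemma geodesic_derivatives (x y : R -> vec) (p : vec) (r : R -> vec) :
  bicycle_path x y -> geodesic_equations x y p r -> forall t,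
  vderive x t = (p + r t)%vec /\
  dot (rod x y t) (r t) = 0 /\
  roll x y t = dot (rod x y t) p /\
  is_vderive (rod x y) t (p + r t - dot (rod x y t) p * rod x y t)%vec /\
  is_vderive r t (dot (rod x y t) p * r t - dot (r t) (p + r t)%vec * rod x y t)%vec.
Proof.
  intros Hp G t. assert (Ex := ge_front x y p r G t).
  assert (Eo : dot (rod x y t) (r t) = 0) by (rewrite dot_comm; apply (ge_orth x y p r G)).
  assert (Er : roll x y t = dot (rod x y t) p)
    by (unfold roll; rewrite Ex; dot_expand; rewrite Eo; ring).
  refine (conj Ex (conj Eo (conj Er (conj _ _)))).
  - eapply is_vderive_eq; [exact (proj2 (proj2 (path_vderive x y Hp t)))|]. now rewrite Ex, Er.
  - assert (D := proj2 (smooth_curve_vderive r (ge_smooth x y p r G)) t).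
    eapply is_vderive_eq; [exact D|]. rewrite (ge_r x y p r G). unfold rod.
    f_equal. f_equal. vec_ring.
Qed.

(** Spinning means [v . p = 0], and differentiating, [x' . p = 0].  So [p] is
    normal to the orthonormal pair [v], [x'], and the Gram determinant gives
    [b^2 = |p|^2]. *)
Lemma geodesic_spins_param (x y : R -> vec) (p : vec) (r : R -> vec) :
  bicycle_path x y -> geodesic_equations x y p r -> spins x y -> param_a x y p = 0.
Proof.
  intros Hp G H.
  assert (Hv := rod_unit x y Hp). assert (Hw := unit_speed_dot x (ge_speed x y p r G)).
  assert (Hvw := spins_orthogonal x y Hp H).
  assert (Hvp : forall t, dot (rod x y t) p = 0).
  { intros t. destruct (geodesic_derivatives x y p r Hp G t) as [_ [_ [E _]]].
    rewrite <- E. apply Hvw. }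
  assert (Hxp : dot (vderive x 0) p = 0).
  { assert (E := derive_dot_const _ _ 0 0 _ _ (proj1 (proj2 (H 0))) (vderive_const p 0) Hvp).
    cbv beta in E. rewrite (dot_comm _ zerov), dot_zero_l in E. lra. }
  unfold param_a, param_b. fold (rod x y 0).
  rewrite gram_identity, Hv, Hw, Hvw, Hxp, (dot_comm p (rod x y 0)), Hvp.
  transitivity (sqrt 0); [f_equal; ring | apply sqrt_0].
Qed.

(** The quantity [b] is conserved, so [a = 0] bounds [|p|^2] by [b(t)^2] at every
    time.  Writing [b^2] as a Gram determinant turns this bound into
    [(p . x')^2 + (v . p)^2 |r|^2 <= 0].  Then [p . x' = 0], so that
    [|r|^2 = 1 + |p|^2 > 0] and [v . p = 0]; the equations reduce to [spins]. *)
Lemma geodesic_param_spins (x y : R -> vec) (p : vec) (r : R -> vec) :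
  bicycle_path x y -> geodesic_equations x y p r -> param_a x y p = 0 -> spins x y.
Proof.
  intros Hp G Ha.
  assert (Hv := rod_unit x y Hp). assert (Hs := unit_speed_dot x (ge_speed x y p r G)).
  assert (D := geodesic_derivatives x y p r Hp G).
  set (b := fun t => dot p (cross (rod x y t) (r t))).
  assert (Eb : forall t, param_b x y p t = b t).
  { intros t. unfold param_b, b. fold (rod x y t).
    rewrite (proj1 (D t)). generalize (rod x y t) (r t). vec_ring. }
  assert (Cb : forall t, b t = b 0).
  { intros t. apply (constant_of_derive_zero b). intros s.
    destruct (D s) as [_ [_ [_ [Dv Dr]]]].
    eapply derive_eq.
    - apply (derive_dot (fun _ => p)); [apply vderive_const|].
      exact (vderive_cross _ _ _ _ _ Dv Dr).
    - generalize (rod x y s) (r s). vec_ring. }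
  (* [sqrt] is 0 on negative numbers, so [a = 0] yields only an inequality. *)
  assert (Hb : forall t, dot p p <= b t ^ 2).
  { intros t. rewrite Cb. unfold param_a in Ha. rewrite Eb in Ha.
    apply Rnot_lt_le. intros Hlt.
    assert (H := sqrt_lt_R0 (dot p p - b 0 ^ 2)). lra. }
  assert (Hqw : forall t, dot p (r t) = - dot p p /\ dot (rod x y t) p = 0).
  { intros t. destruct (D t) as [Ex [Eo _]]. specialize (Hb t). unfold b in Hb.
    rewrite gram_identity, Hv, Eo, (dot_comm (r t) p), (dot_comm p (rod x y t)) in Hb.
    assert (Hn := Hs t). rewrite Ex in Hn.
    rewrite dot_add_l, !dot_add_r, (dot_comm (r t) p) in Hn.
    assert (P := dot_self_nonneg p). assert (Q := dot_self_nonneg (r t)).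
    set (w := dot (rod x y t) p) in *. set (pr := dot p (r t)) in *.
    set (pp := dot p p) in *. set (rr := dot (r t) (r t)) in *.
    assert (Hrr : rr = 1 - pp - 2 * pr) by lra.
    assert (Hsum : (pr + pp) ^ 2 + w ^ 2 * rr <= 0) by (rewrite Hrr in *; nra).
    assert (H1 : 0 <= w ^ 2 * rr) by (apply Rmult_le_pos; [apply pow2_ge_0 | trivial]).
    assert (H2 : pr + pp = 0) by nra.
    split; [lra|].
    assert (rr = 1 + pp) by lra.
    assert (w ^ 2 * rr = 0) by nra. nra. }
  intros t. destruct (D t) as [Ex [Eo [Ek [Dv Dr]]]]. destruct (Hqw t) as [Hq Hw].
  assert (Dx' : is_vderive (vderive x) t (-1 * rod x y t)%vec).
  { apply (is_vderive_ext (fun s => p + r s)%vec); [intros s; symmetry; apply D|].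
    eapply is_vderive_eq; [apply vderive_add; [apply vderive_const | exact Dr]|].
    assert (Hn := Hs t). rewrite Ex in Hn. revert Hn. dot_expand.
    rewrite (dot_comm (r t) p). intros Hn. rewrite Hw, Hq.
    replace (- dot p p + dot (r t) (r t)) with 1 by lra. vec_ring. }
  split; [|split; [|exact Dx']].
  - eapply is_vderive_eq; [exact (proj1 (proj2 (path_vderive x y Hp t)))|].
    rewrite Ek, Hw. vec_ring.
  - eapply is_vderive_eq; [exact Dv|]. rewrite Hw, Ex. vec_ring.
Qed.

(** * Closed geodesics *)

(** The dilation [y + e (y - y(t0))] over one period starting at [t0] is the
    rolling variation with [kappa = k]; its first variation is [int k^2]. *)
Lemma closed_roll (x y : R -> vec) :
  bicycling_geodesic x y -> closed_path x y -> forall t, roll x y t = 0.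
Proof.
  intros HG [T [HT Hper]] t. assert (Hp := proj1 HG).
  (* Centring the period at [t] puts [t] in the open interval where the
     integrand vanishes. *)
  set (t0 := t - T / 2). assert (Sk := smooth_roll x y Hp).
  destruct (smooth_primitive (fun s => roll x y s * roll x y s) t0) as [F [_ [_ [DF _]]]];
    [now apply smooth_mult|].
  apply (integral_square_zero F _ t0 (t0 + T)); [exact DF | | unfold t0; lra].
  symmetry. apply (rolling_variation x y t0 (t0 + T) (roll x y) F (fun s => y s - y t0)%vec);
    trivial; try lra.
  - apply smooth_curve_sub; [apply Hp | apply smooth_curve_const].
  - intros s. eapply is_vderive_eq.
    + apply vderive_sub; [exact (proj1 (proj2 (path_vderive x y Hp s))) | apply vderive_const].
    + vec_ring.
  - vec_ring.
  - rewrite (proj2 (Hper t0)). vec_ring.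
Qed.

(** For [m = u . (v x v')] with mean [mu] over [[t0, t1]], the angle [phi] with
    [phi' = m - mu] vanishes at both ends.  The first variation [int phi' m]
    equals [int (m - mu)^2], so [m] is constant. *)
Lemma angular_momentum_constant (x y : R -> vec) (u : vec) :
  bicycling_geodesic x y -> (forall t, roll x y t = 0) -> dot u u = 1 ->
  forall s t, dot u (cross (rod x y s) (vderive x s)) = dot u (cross (rod x y t) (vderive x t)).
Proof.
  intros HG Hroll Hu. assert (Hp := proj1 HG).
  set (m := fun t => dot u (cross (rod x y t) (vderive x t))).
  assert (Sm : smooth m).
  { apply (smooth_dot (fun _ => u)); [apply smooth_curve_const|].
    apply smooth_curve_cross; [now apply smooth_rod | apply smooth_curve_vderive, Hp]. }
  assert (Hmean : forall t0 t1, t0 < t1 -> exists mu, forall t, t0 < t < t1 -> m t = mu).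
  { intros t0 t1 Ht. destruct (smooth_primitive m t0 Sm) as [M [SM [M0 [DM _]]]].
    set (mu := M t1 / (t1 - t0)). exists mu.
    set (phi := fun t => M t - mu * (t - t0)).
    assert (Dphi : forall t, is_derive phi t (m t - mu)).
    { intros t. eapply derive_eq.
      - apply derive_minus; [apply DM|]. apply is_derive_scal.
        apply derive_minus; [apply @is_derive_id | apply derive_const].
      - unfold one; simpl; ring. }
    assert (Sphi' : smooth (fun t => m t - mu)) by (apply smooth_minus; [trivial | apply smooth_const]).
    assert (Sphi := smooth_of_derive _ _ Sphi' Dphi).
    destruct (smooth_primitive (fun t => (m t - mu) * m t) t0) as [F [_ [_ [DF _]]]];
      [now apply smooth_mult|].
    assert (P0 : phi t0 = 0) by (unfold phi; rewrite M0; ring).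
    assert (P1 : phi t1 = 0) by (unfold phi, mu; field; lra).
    assert (EF : F t1 = F t0).
    { apply (turning_variation x y u t0 t1 phi F); trivial.
      intros t. now rewrite (is_derive_unique _ _ _ (Dphi t)). }
    intros t Htt. apply Rminus_diag_uniq.
    apply (integral_square_zero (fun s => F s - mu * phi s) (fun s => m s - mu) t0 t1); trivial.
    - intros s. eapply derive_eq; [apply derive_minus; [apply DF | apply is_derive_scal, Dphi]|].
      cbv beta. ring.
    - now rewrite EF, P0, P1. }
  intros s t. destruct (Hmean (Rmin s t - 1) (Rmax s t + 1)) as [mu Hmu].
  - assert (H1 := Rmin_l s t). assert (H2 := Rmax_l s t). lra.
  - assert (H1 := Rmin_l s t). assert (H2 := Rmax_l s t).
    assert (H3 := Rmin_r s t). assert (H4 := Rmax_r s t).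
    change (m s = m t). rewrite !Hmu; trivial; lra.
Qed.

(** Constancy of [v x v'] gives [v x x'' = 0], and [v . x' = 0] differentiates to
    [v . x'' = -1]; together [x'' = -v]. *)
Lemma nonrolling_spins (x y : R -> vec) :
  bicycling_geodesic x y -> (forall t, roll x y t = 0) -> spins x y.
Proof.
  intros HG Hroll. assert (Hp := proj1 HG). assert (Hd := path_vderive x y Hp).
  assert (Hv := rod_unit x y Hp). assert (Hs := unit_speed_dot x (proj1 (proj2 HG))).
  assert (Dv : forall t, is_vderive (rod x y) t (vderive x t)).
  { intros t. eapply is_vderive_eq; [exact (proj2 (proj2 (Hd t)))|]. rewrite Hroll. vec_ring. }
  destruct (smooth_curve_vderive x (proj1 Hp)) as [Sx' _].
  destruct (smooth_curve_vderive _ Sx') as [_ Dx'].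
  intros t. split; [|split; [apply Dv|]].
  - eapply is_vderive_eq; [exact (proj1 (proj2 (Hd t)))|]. rewrite Hroll. vec_ring.
  - eapply is_vderive_eq; [apply Dx'|].
    set (a := vderive (vderive x) t).
    assert (Hcross : forall u, dot u u = 1 -> dot u (cross (rod x y t) a) = 0).
    { intros u Hu.
      assert (Dc := vderive_cross _ _ _ _ _ (Dv t) (Dx' t)).
      assert (E := derive_dot_const _ _ t _ _ _ (vderive_const u t) Dc
                (fun s => angular_momentum_constant x y u HG Hroll Hu s t)).
      fold a in E. revert E. generalize (rod x y t) (vderive x t) a. intros v w z E.
      rewrite <- E. vec_ring. }
    assert (E0 : cross (rod x y t) a = zerov).
    { assert (Hbasis := conj (Hcross (1, 0, 0)) (conj (Hcross (0, 1, 0)) (Hcross (0, 0, 1)))).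
      destruct (cross (rod x y t) a) as [[w1 w2] w3]. vec_unfold.
      apply vec_ext; unfold c1, c2, c3; cbn [fst snd]; lra. }
    assert (E1 := derive_dot_const _ _ t _ _ _ (Dv t) (Dx' t) Hroll). fold a in E1.
    rewrite Hs in E1.
    transitivity (1 * a)%vec; [vec_ring|]. rewrite <- (Hv t).
    transitivity (dot (rod x y t) a * rod x y t - cross (rod x y t) (cross (rod x y t) a))%vec;
      [generalize (rod x y t) a; vec_ring|].
    rewrite E0. replace (dot (rod x y t) a) with (-1) by lra.
    generalize (rod x y t). vec_ring.
Qed.

(** * Orthogonal projection onto a span of functions *)

Definition inner (a b : R) (f g : R -> R) : R := RInt (fun t => f t * g t) a b.

Fixpoint span (fs : list (R -> R)) (g : R -> R) : Prop :=
  match fs with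
  | nil => g = fun _ => 0
  | f :: fs => exists q g', span fs g' /\ g = fun t => q * f t + g' t
  end.

Lemma smooth_ex_RInt (f : R -> R) (a b : R) : smooth f -> ex_RInt f a b.
Proof.
  intros Hf. apply (@ex_RInt_continuous R_CompleteNormedModule). intros t _.
  now apply smooth_continuous.
Qed.

Lemma inner_linear (a b q : R) (f g h : R -> R) :
  smooth f -> smooth g -> smooth h ->
  inner a b (fun t => f t - q * g t) h = inner a b f h - q * inner a b g h.
Proof.
  intros Hf Hg Hh. unfold inner. apply is_RInt_unique.
  apply (is_RInt_ext (fun t => minus (f t * h t) (scal q (g t * h t)))).
  - intros t _. unfold minus, plus, opp, scal; simpl; unfold mult; simpl. ring.
  - apply (is_RInt_minus (fun t => f t * h t)).
    + apply (@RInt_correct R_CompleteNormedModule), smooth_ex_RInt, smooth_mult; trivial.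
    + apply (is_RInt_scal (fun t => g t * h t)).
      apply (@RInt_correct R_CompleteNormedModule), smooth_ex_RInt, smooth_mult; trivial.
Qed.

Lemma inner_sym (a b : R) (f g : R -> R) : inner a b f g = inner a b g f.
Proof. unfold inner. apply RInt_ext. intros; apply Rmult_comm. Qed.

Lemma span_smooth (fs : list (R -> R)) :
  List.Forall smooth fs -> forall g, span fs g -> smooth g.
Proof.
  induction 1 as [|f fs Hf Hfs IH]; cbn [span]; intros g.
  - intros ->. apply smooth_const.
  - intros [q [g' [Hg' ->]]]. apply smooth_plus; [|auto].
    apply smooth_mult; [apply smooth_const | trivial].
Qed.

Lemma span_linear (fs : list (R -> R)) (q : R) (g h : R -> R) :
  span fs g -> span fs h -> span fs (fun t => g t - q * h t).
Proof.
  revert g h. induction fs as [|f fs IH]; cbn [span]; intros g h.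
  - intros -> ->. apply functional_extensionality; intros; ring.
  - intros [a [g' [Hg ->]]] [b [h' [Hh ->]]].
    exists (a - q * b), (fun t => g' t - q * h' t). split; [auto|].
    apply functional_extensionality; intros; ring.
Qed.

Lemma span_orthogonal (a b : R) (fs : list (R -> R)) (h : R -> R) :
  List.Forall smooth fs -> smooth h -> List.Forall (fun f => inner a b h f = 0) fs ->
  forall g, span fs g -> inner a b h g = 0.
Proof.
  intros Sfs Sh. induction Sfs as [|f fs Sf Sfs IH]; cbn [span]; intros Ho g.
  - intros ->. unfold inner. transitivity (RInt (fun _ => 0) a b).
    + apply RInt_ext. intros; apply Rmult_0_r.
    + rewrite (@RInt_const R_CompleteNormedModule). unfold scal; simpl; unfold mult; simpl. ring.
  - intros [q [g' [Hg' ->]]]. inversion_clear Ho as [|? ? Hf Hfs].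
    rewrite inner_sym.
    replace (fun t => q * f t + g' t) with (fun t => g' t - (- q) * f t)
      by (apply functional_extensionality; intros; ring).
    rewrite inner_linear, (inner_sym _ _ g'), (inner_sym _ _ f); trivial.
    + rewrite Hf, IH; trivial. ring.
    + now apply (span_smooth fs).
Qed.

(** This covers the degenerate Gram-Schmidt step, where a function is already in
    the span of the others; it occurs when the rod stays in a plane. *)
Lemma inner_self_zero (a b : R) (f h : R -> R) :
  a < b -> smooth f -> smooth h -> inner a b f f = 0 -> inner a b h f = 0.
Proof.
  intros Hab Sf Sh Hff.
  destruct (smooth_primitive (fun t => f t * f t) a) as [F [_ [F0 [DF EF]]]];
    [now apply smooth_mult|].
  assert (Hz : forall t, a < t < b -> f t = 0).
  { apply (integral_square_zero F); trivial. now rewrite F0, EF. }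
  unfold inner. transitivity (RInt (fun _ => 0) a b).
  - apply RInt_ext. intros t. rewrite Rmin_left, Rmax_right by lra. intros Ht.
    rewrite Hz; trivial. apply Rmult_0_r.
  - rewrite (@RInt_const R_CompleteNormedModule). unfold scal; simpl; unfold mult; simpl. ring.
Qed.

(** Gram-Schmidt on the list: [f' = f - s] and [h' = h - s'] are the residues
    modulo the tail, and [h' - q f'] is orthogonal to the tail and to [f']. *)
Lemma orthogonal_projection (a b : R) (fs : list (R -> R)) (h : R -> R) :
  a < b -> List.Forall smooth fs -> smooth h ->
  exists g, span fs g /\ List.Forall (fun f => inner a b (fun t => h t - g t) f = 0) fs.
Proof.
  intros Hab Sfs. revert h. induction Sfs as [|f fs Sf Sfs IH]; intros h Sh.
  - exists (fun _ => 0). split; [reflexivity | constructor].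
  - destruct (IH f Sf) as [s [Hs Os]]. destruct (IH h Sh) as [s' [Hs' Os']].
    set (f' := fun t => f t - s t) in *. set (h' := fun t => h t - s' t) in *.
    assert (Ss := span_smooth fs Sfs s Hs). assert (Ss' := span_smooth fs Sfs s' Hs').
    assert (Sf' : smooth f') by now apply smooth_minus.
    assert (Sh' : smooth h') by now apply smooth_minus.
    assert (Hq : exists q, inner a b (fun t => h' t - q * f' t) f' = 0).
    { destruct (Req_dec (inner a b f' f') 0) as [E | E].
      - exists 0. rewrite inner_linear, (inner_self_zero a b f' h'); trivial. ring.
      - exists (inner a b h' f' / inner a b f' f'). rewrite inner_linear; trivial. field. trivial. }
    destruct Hq as [q Hq].
    exists (fun t => q * f t + (s' t - q * s t)). split.
    { exists q, (fun t => s' t - q * s t). split; trivial. now apply span_linear. }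
    replace (fun t => h t - (q * f t + (s' t - q * s t))) with (fun t => h' t - q * f' t)
      by (apply functional_extensionality; intros; unfold h', f'; ring).
    assert (Ofs : List.Forall (fun g => inner a b (fun t => h' t - q * f' t) g = 0) fs).
    { apply Forall_forall. intros g Hg.
      rewrite Forall_forall in Os, Os', Sfs.
      rewrite inner_linear; auto. rewrite Os, Os'; trivial. ring. }
    assert (Sd : smooth (fun t => h' t - q * f' t)).
    { apply smooth_minus; trivial. apply smooth_mult; trivial. apply smooth_const. }
    constructor; trivial.
    assert (E := span_orthogonal a b fs _ Sfs Sd Ofs s Hs).
    rewrite inner_sym.
    replace f with (fun t => f' t - (-1) * s t)
      by (apply functional_extensionality; intros; unfold f'; ring).
    rewrite inner_linear, (inner_sym _ _ f'), (inner_sym _ _ s), Hq, E; trivial. ring.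
Qed.

(** * Geodesics whose front track is a unit circle *)

(** For [kappa = k - v . p], with [v . p] the projection of [k] onto the span of
    the coordinates of [v], the primitive [W] of [kappa v] vanishes at both
    ends.  So [int kappa k = 0]; since also [int kappa (v . p) = 0], the integral
    of [kappa^2] is 0. *)
Lemma roll_multiplier (x y : R -> vec) (t0 t1 : R) :
  bicycling_geodesic x y -> t0 < t1 ->
  exists p, forall t, t0 < t < t1 -> roll x y t - dot (rod x y t) p = 0.
Proof.
  intros HG Ht. assert (Hp := proj1 HG). assert (Sk := smooth_roll x y Hp).
  assert (Srod := smooth_rod x y Hp).
  destruct (proj1 (smooth_curve_comp _) Srod) as [S1 [S2 S3]].
  set (v1 := fun t => c1 (rod x y t)) in *. set (v2 := fun t => c2 (rod x y t)) in *.
  set (v3 := fun t => c3 (rod x y t)) in *.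
  destruct (orthogonal_projection t0 t1 (v1 :: v2 :: v3 :: nil) (roll x y))
    as [g [Hg Ho]]; trivial; [repeat constructor; trivial|].
  cbn [span] in Hg.
  destruct Hg as [p1 [g1 [[p2 [g2 [[p3 [g3 [-> ->]]] ->]]] ->]]].
  exists (p1, p2, p3).
  set (kappa := fun t => roll x y t - dot (rod x y t) (p1, p2, p3)).
  assert (Sk' : smooth kappa).
  { apply smooth_minus; trivial. apply (smooth_dot (rod x y) (fun _ => (p1, p2, p3))); trivial.
    apply smooth_curve_const. }
  assert (Hin : forall f, List.In f (v1 :: v2 :: v3 :: nil) -> RInt (fun t => kappa t * f t) t0 t1 = 0).
  { intros f Hf. rewrite Forall_forall in Ho. rewrite <- (Ho f Hf). apply RInt_ext.
    intros t _. f_equal. unfold kappa, dot, v1, v2, v3. unfold c1 at 2, c2 at 2, c3 at 2.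
    cbn [fst snd]. ring. }
  destruct (smooth_primitive (fun t => kappa t * v1 t) t0) as [W1 [SW1 [W10 [DW1 EW1]]]];
    [now apply smooth_mult|].
  destruct (smooth_primitive (fun t => kappa t * v2 t) t0) as [W2 [SW2 [W20 [DW2 EW2]]]];
    [now apply smooth_mult|].
  destruct (smooth_primitive (fun t => kappa t * v3 t) t0) as [W3 [SW3 [W30 [DW3 EW3]]]];
    [now apply smooth_mult|].
  assert (W11 : W1 t1 = 0) by (rewrite EW1; apply Hin; cbn; auto).
  assert (W21 : W2 t1 = 0) by (rewrite EW2; apply Hin; cbn; auto).
  assert (W31 : W3 t1 = 0) by (rewrite EW3; apply Hin; cbn; auto).
  destruct (smooth_primitive (fun t => kappa t * roll x y t) t0) as [F [_ [_ [DF _]]]];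
    [now apply smooth_mult|].
  set (W := fun t => (W1 t, W2 t, W3 t)).
  assert (EF : F t1 = F t0).
  { apply (rolling_variation x y t0 t1 kappa F W); trivial.
    - apply smooth_curve_comp. exact (conj SW1 (conj SW2 SW3)).
    - intros t. exact (conj (DW1 t) (conj (DW2 t) (DW3 t))).
    - unfold W. now rewrite W10, W20, W30.
    - unfold W. now rewrite W11, W21, W31. }
  apply (integral_square_zero (fun t => F t - (p1 * W1 t + p2 * W2 t + p3 * W3 t)) kappa).
  - intros t. eapply derive_eq.
    + apply derive_minus; [apply DF|].
      apply derive_plus; [apply derive_plus|]; apply is_derive_scal; trivial.
    + cbv beta. unfold kappa, dot, v1, v2, v3. unfold c1 at 4, c2 at 4, c3 at 4.
      unfold c1, c2, c3; cbn [fst snd]. ring.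
  - rewrite W10, W20, W30, W11, W21, W31, EF. ring.
Qed.

Lemma linear_ode_zero (g k : R -> R) (s : R) :
  smooth k -> (forall t, is_derive g t (- k t * g t)) -> g s = 0 -> forall t, g t = 0.
Proof.
  intros Sk Dg Hs t. destruct (smooth_primitive k 0 Sk) as [K [_ [_ [DK _]]]].
  assert (E : g t * exp (K t) = g s * exp (K s)).
  { apply (constant_of_derive_zero (fun u => g u * exp (K u))). intros u.
    eapply derive_eq; [apply derive_mult; [apply Dg | apply derive_exp_comp, DK]|].
    cbv beta. ring. }
  rewrite Hs, Rmult_0_l in E. assert (H := exp_pos (K t)).
  apply Rmult_integral in E. lra.
Qed.

(** The vector [x'' + (x - c)] is orthogonal to the radius, the velocity and the
    normal [n], by differentiating the constraints on the circle. *)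
Lemma circular_acceleration (x : R -> vec) (c n : vec) :
  smooth_curve x -> unit_speed x -> dot n n = 1 ->
  (forall t, dot (x t - c)%vec (x t - c)%vec = 1) -> (forall t, dot n (x t - c)%vec = 0) ->
  forall t, is_vderive (vderive x) t (-1 * (x t - c))%vec.
Proof.
  intros Sx Hs' Hn Hc Hplane t. assert (Hs := unit_speed_dot x Hs').
  destruct (smooth_curve_vderive x Sx) as [Sx' Dx].
  destruct (smooth_curve_vderive _ Sx') as [_ Dx'].
  set (nu := fun t => (x t - c)%vec).
  assert (Dnu : forall t, is_vderive nu t (vderive x t)).
  { intros s. eapply is_vderive_eq; [apply vderive_sub; [apply Dx | apply vderive_const]|]. vec_ring. }
  assert (H1 : forall s, dot (vderive x s) (nu s) = 0).
  { intros s. assert (E := derive_dot_const _ _ s 1 _ _ (Dnu s) (Dnu s) Hc).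
    rewrite (dot_comm (nu s)) in E. lra. }
  assert (H2 : forall s, dot n (vderive x s) = 0).
  { intros s. assert (E := derive_dot_const _ _ s 0 _ _ (vderive_const n s) (Dnu s) Hplane).
    rewrite dot_zero_l in E. lra. }
  set (a := vderive (vderive x) t).
  assert (E1 := derive_dot_const _ _ t 0 _ _ (Dx' t) (Dnu t) H1).
  assert (E2 := derive_dot_const _ _ t 1 _ _ (Dx' t) (Dx' t) Hs).
  assert (E3 := derive_dot_const _ _ t 0 _ _ (vderive_const n t) (Dx' t) H2).
  cbv beta in E1, E2, E3. fold a in E1, E2, E3. rewrite dot_zero_l in E3.
  rewrite (dot_comm (vderive x t) a) in E2. rewrite Hs in E1.
  eapply is_vderive_eq; [apply Dx'|]. fold a. fold (nu t).
  assert (Hz : (a + nu t)%vec = zerov).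
  { assert (Hcn : dot (nu t) (nu t) = 1) by apply Hc.
    assert (Hpn : dot n (nu t) = 0) by apply Hplane.
    apply (zero_of_orthonormal (nu t) (vderive x t) n); dot_expand; trivial.
    - rewrite dot_comm. apply H1.
    - rewrite dot_comm. apply H2.
    - lra.
    - rewrite (dot_comm (nu t)), H1. lra.
    - rewrite (dot_comm a), (dot_comm (nu t) n). lra. }
  transitivity ((a + nu t) - nu t)%vec; [|rewrite Hz]; generalize (nu t); vec_ring.
Qed.

(** The quantity [1 - v . nu] satisfies a linear equation, so one zero suffices;
    the zero comes from the multiplier [p] at a time when [p . x' = 0].  For the
    unit vectors [v] and [nu], [v . nu = 1] means [v = nu]: the rod is the
    radius, orthogonal to the velocity, and the rolling speed is 0. *)
Lemma circle_spins (x y : R -> vec) :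
  bicycling_geodesic x y -> track_is_unit_circle x -> spins x y.
Proof.
  intros HG [c [n [Hn Hq]]]. assert (Hp := proj1 HG).
  assert (Hs := proj1 (proj2 HG)). apply vnorm_one in Hn.
  assert (Hc : forall t, dot (x t - c)%vec (x t - c)%vec = 1).
  { intros t. apply vnorm_one, (Hq (x t)). now exists t. }
  assert (Hplane : forall t, dot n (x t - c)%vec = 0).
  { intros t. apply (Hq (x t)). now exists t. }
  assert (Dx' := circular_acceleration x c n (proj1 Hp) Hs Hn Hc Hplane).
  assert (Hs' := unit_speed_dot x Hs). assert (Hv := rod_unit x y Hp).
  assert (Hd := path_vderive x y Hp).
  set (nu := fun t => (x t - c)%vec) in *.
  assert (Dnu : forall t, is_vderive nu t (vderive x t)).
  { intros s. eapply is_vderive_eq; [apply vderive_sub; [exact (proj1 (Hd s)) | apply vderive_const]|]. vec_ring. }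
  assert (Htn : forall s, dot (vderive x s) (nu s) = 0).
  { intros s. assert (E := derive_dot_const _ _ s 1 _ _ (Dnu s) (Dnu s) Hc).
    rewrite (dot_comm (nu s)) in E. lra. }
  assert (Hpi := PI_RGT_0).
  (* The interval exceeds one period on both sides: the mean value point [xi]
     may be an end of [[0, 2 PI]], and [k = v . p] is differentiated there. *)
  destruct (roll_multiplier x y (-1) (2 * PI + 1)) as [p Hk]; trivial; [lra|].
  assert (Hxi : exists xi, 0 <= xi <= 2 * PI /\ dot p (vderive x xi) = 0).
  { assert (Df : forall t, is_derive (fun s => dot p (nu s)) t (dot p (vderive x t))).
    { intros t. eapply derive_eq; [apply (derive_dot (fun _ => p)); [apply vderive_const | apply Dnu]|].
      cbv beta. rewrite dot_zero_l. ring. }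
    destruct (MVT_gen (fun s => dot p (nu s)) 0 (2 * PI) (fun t => dot p (vderive x t)))
      as [xi [H1 H2]].
    - intros; apply Df.
    - intros; eapply derive_continuity_pt; apply Df.
    - rewrite Rmin_left, Rmax_right in H1 by lra. exists xi. split; trivial.
      assert (Eper := harmonic_periodic nu (vderive x) Dnu Dx' 0).
      rewrite Rplus_0_l in Eper. rewrite Eper in H2. nra. }
  destruct Hxi as [xi [Hxi Hpx]].
  (* Differentiating [v . x' - v . p = 0] gives
     [1 - k^2 - v . nu - (p . x' - k (v . p)) = 0]. *)
  assert (Hmeet : dot (rod x y xi) (nu xi) = 1).
  { destruct (Hd xi) as [_ [_ Dv]].
    assert (E := derive_zero_of_constant_on _ _ _ 0 _ xi Hk ltac:(lra)
      (derive_minus _ _ _ _ _ (derive_dot _ _ _ _ _ Dv (Dx' xi))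
         (derive_dot _ _ _ _ _ Dv (vderive_const p xi)))).
    cbv beta in E. specialize (Hk xi ltac:(lra)). revert E.
    rewrite (dot_comm _ zerov), dot_zero_l. fold (nu xi).
    dot_expand. fold (roll x y xi). rewrite (dot_comm (vderive x xi) p), Hpx, Hs'.
    intros E.
    replace (dot (rod x y xi) p) with (roll x y xi) in E by lra.
    lra. }
  assert (Hall : forall t, dot (rod x y t) (nu t) = 1).
  { intros t. apply Rminus_diag_uniq_sym. revert t.
    apply (linear_ode_zero (fun t => 1 - dot (rod x y t) (nu t)) (roll x y) xi).
    - now apply smooth_roll.
    - intros t. destruct (Hd t) as [_ [_ Dv]].
      eapply derive_eq; [exact (derive_minus _ _ _ _ _ (derive_const 1 t)
         (derive_dot _ _ _ _ _ Dv (Dnu t)))|].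
      dot_expand. rewrite Htn. fold (roll x y t). ring.
    - lra. }
  assert (Erod : forall t, rod x y t = nu t).
  { intros t. apply vec_eq_of_dot. assert (Hcn : dot (nu t) (nu t) = 1) by apply Hc.
    dot_expand. rewrite (dot_comm (nu t) (rod x y t)), Hall, Hv, Hcn. ring. }
  assert (Hroll : forall t, roll x y t = 0).
  { intros t. unfold roll. rewrite Erod, dot_comm. apply Htn. }
  now apply nonrolling_spins.
Qed.

Lemma closed_spins (x y : R -> vec) :
  bicycling_geodesic x y -> closed_path x y -> spins x y.
Proof. intros HG Hc. apply nonrolling_spins; trivial. now apply closed_roll. Qed.

Theorem proposition3p6 (x y : R -> vec) (Hgeo : bicycling_geodesic x y) :
  (closed_path x y <-> track_is_unit_circle x) /\
  (closed_path x y <->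
     exists (p : vec) (r : R -> vec),
       geodesic_equations x y p r /\ param_a x y p = 0) /\
  (forall (p : vec) (r : R -> vec), geodesic_equations x y p r ->
     (closed_path x y <-> param_a x y p = 0)).
Proof.
  assert (Hp := proj1 Hgeo). assert (Hs := proj1 (proj2 Hgeo)).
  split; [|split].
  - split; intros H.
    + now apply (spins_track x y), closed_spins.
    + now apply spins_closed, circle_spins.
  - split.
    + intros H. exists zerov, (vderive x). now apply spins_geodesic_equations, closed_spins.
    + intros [p [r [G Ha]]]. now apply spins_closed, (geodesic_param_spins x y p r).
  - intros p r G. split; intros H.
    + now apply (geodesic_spins_param x y p r), closed_spins.
    + now apply spins_closed, (geodesic_param_spins x y p r).
Qed.
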